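(* Let $(q_n)$ be a sequence of positive integers with $q_n/n\to0$ and $q_n\asymp(\log n)^{\delta_2}$ for some $\delta_2>0$. Let $X_i=\theta_i+\epsilon_i$, $i=1,\dots,n$, with $\epsilon_i$ i.i.d. $N(0,1)$, write $\mathbf X=(X_1,\dots,X_n)$, and consider testing $H_{0i}:\theta_i=0$ against $H_{1i}:\theta_i\neq0$ simultaneously for $i=1,\dots,n$ with the full Bayes rule $\boldsymbol\psi=(\psi_1,\dots,\psi_n)$, $$\psi_i=\mathbf 1\Bigl\{\mathbb E(1-\kappa_i\mid\mathbf X)>\tfrac12\Bigr\},$$ where $\mathbb E(1-\kappa_i\mid\mathbf X)$ (defined in the context) is the posterior mean of $1-\kappa_i$ under the hierarchical one-group prior with exponent $a=\tfrac12$, slowly varying function $L$, and prior density $\pi_2$ (which may depend on $n$) on the global parameter $\tau$. Assume that $L$ satisfies (A1) and (A2) of the context, and that $\pi_2$ satisfies $\int_{1/n}^{\alpha_n}\pi_2(\tau)\,d\tau=1$, where $\alpha_n=c\,(\log n)^{\delta_3}/n$ for some constants $c>0$ and $0<\delta_3<\tfrac12$ (so that $\alpha_n\to0$ and $n\alpha_n\to\infty$). Then for every fixed $b\in\mathbb R$, $$\sup_{\boldsymbol\theta\in\boldsymbol\Theta_b}R(\boldsymbol\theta,\boldsymbol\psi)=1-\Phi(b)+o(1)\qquad (n\to\infty),$$ where $R=\mathrm{FDR}+\mathrm{FNR}$ and the beta-min class $\boldsymbol\Theta_b$ are defined in the context. The same conclusion holds with $b$ replaced by any real sequence $b=b_n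\to\infty$.
   Context: Hierarchical one-group shrinkage prior: $\tau$ has density $\pi_2$; given $\tau$, independently over $i$, $\theta_i\mid\lambda_i,\tau\sim N(0,\lambda_i^2\tau^2)$ and $\lambda_i^2$ has probability density $\pi_1(t)=K\,t^{-a-1}L(t)$ on $(0,\infty)$, where $a>0$, $L:(0,\infty)\to(0,\infty)$ is measurable, continuous and slowly varying (at infinity), and $K>0$ is the normalizing constant; $a$ and $L$ do not depend on $n$. (Horseshoe-type priors are those with $a=\tfrac12$.) The condition $1/n<\alpha_n$ is understood for all sufficiently large $n$. Shrinkage coefficient: $\kappa_i=1/(1+\lambda_i^2\tau^2)$. For fixed $\tau$, $\mathbb E(1-\kappa_i\mid X_i,\tau)$ denotes the posterior mean of $1-\kappa_i$ given $X_i$ under $X_i\mid\theta_i\sim N(\theta_i,1)$; explicitly $$\mathbb E(1-\kappa_i\mid X_i=x,\tau)=\frac{\int_0^\infty \frac{t\tau^2}{1+t\tau^2}(1+t\tau^2)^{-1/2}e^{-x^2/(2(1+t\tau^2))}\,t^{-a-1}L(t)\,dt}{\int_0^\infty (1+t\tau^2)^{-1/2}e^{-x^2/(2(1+t\tau^2))}\,t^{-a-1}L(t)\,dt}.$$ The full Bayes coefficient is $\mathbb E(1-\kappa_i\mid\mathbf X)=\int_{1/n}^{\alpha_n}\mathbb E(1-\kappa_i\mid X_i,\tau)\,\pi(\tau\mid\mathbf X)\,d\tau$, where $\pi(\tau\mid\mathbf X)$ is the posterior density of $\tau$, i.e. $\pi(\tau\mid\mathbf X)\propto\pi_2(\tau)\prod_{i=1}^n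 m_\tau(X_i)$ with $m_\tau(x)=\int_0^\infty(2\pi(1+t\tau^2))^{-1/2}e^{-x^2/(2(1+t\tau^2))}\pi_1(t)\,dt$. Assumptions on $L$: (A1) there exist $c_0>0$ and $t_0>0$ such that $L(t)\ge c_0$ for all $t\ge t_0$; (A2) there exists $M\in(0,\infty)$ such that $\sup_{t\in(0,\infty)}L(t)\le M$. Beta-min class: for real $b$ (possibly depending on $n$), $\boldsymbol\Theta_b=\{\boldsymbol\theta\in\mathbb R^n:\ |S_{\boldsymbol\theta}|=q_n,\ |\theta_i|\ge\sqrt{2\log(n/q_n)}+b\ \text{for all } i\in S_{\boldsymbol\theta}\}$, where $S_{\boldsymbol\theta}=\{i:\theta_i\ne0\}$. Risk: $R(\boldsymbol\theta,\boldsymbol\psi)=\mathrm{FDR}(\boldsymbol\theta,\boldsymbol\psi)+\mathrm{FNR}(\boldsymbol\theta,\boldsymbol\psi)$, where $$\mathrm{FDR}(\boldsymbol\theta,\boldsymbol\psi)=\mathbb E_{\boldsymbol\theta}\left[\frac{\sum_{i:\theta_i=0}\psi_i}{\max\{\sum_{i=1}^n\psi_i,1\}}\right],\qquad \mathrm{FNR}(\boldsymbol\theta,\boldsymbol\psi)=\mathbb E_{\boldsymbol\theta}\left[\frac{\sum_{i:\theta_i\ne0}(1-\psi_i)}{\max\{|S_{\boldsymbol\theta}|,1\}}\right].$$ $\mathbb E_{\boldsymbol\theta}$ is expectation when the true mean vector is the fixed vector $\boldsymbol\theta$. $\Phi$ is the standard normal distribution function. For sequences, $a_n\asymp b_n$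 means $0<c'\le a_n/b_n\le c''<\infty$ for some constants $c',c''$ and all sufficiently large $n$. *)

(* Defs.v *)
From HB Require Import structures.
From mathcomp Require Import all_boot all_order all_algebra.
From mathcomp Require Import all_classical all_reals all_analysis.

Set Implicit Arguments.
Unset Strict Implicit.
Unset Printing Implicit Defensive.

Import Order.TTheory GRing.Theory Num.Theory.
Import numFieldNormedType.Exports.

Local Open Scope classical_set_scope.
Local Open Scope ring_scope.

Section asymptotics.
Context {R : realType}.

Definition asymp_equiv (u v : nat -> R) : Prop :=
  exists c1 c2 : R, 0 < c1 /\ \forall n \near \oo, c1 <= u n / v n <= c2.

Definition slowly_varying (L : R -> R) : Prop :=
  [/\ measurable_fun (`]0, +oo[ : set R) L,
      (forall t, 0 < t -> 0 < L t) &
      (forall x, 0 < x -> L (x * t) / L t @[t --> +oo] --> (1 : R))].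

End asymptotics.

Section probability_notions.
Context {R : realType}.

Definition prob_density_pos (f : R -> R) : Prop :=
  [/\ measurable_fun (`]0, +oo[ : set R) f,
      (forall t, 0 < t -> 0 <= f t) &
      (\int[lebesgue_measure]_(t in `]0%R, +oo[) (f t)%:E = 1)%E].

Definition mutually_independent (I : finType) (d : measure_display)
    (T : measurableType d) (P : probability T R) (X : I -> {RV P >-> R}) : Prop :=
  forall (J : {set I}) (A : I -> set R),
    (forall i, i \in J -> measurable (A i)) ->
    P (\bigcap_(i in [set` J]) X i @^-1` A i) =
    (\prod_(i in J) P (X i @^-1` A i))%E.

Definition iid_std_normal (I : finType) (d : measure_display)
    (T : measurableType d) (P : probability T R) (X : I -> {RV P >-> R}) : Prop :=
  (forall i (A : set R), measurable A ->
     distribution P (X i) A = normal_prob 0 1 A) /\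
  mutually_independent X.

Definition Phi (x : R) : R := fine (normal_prob 0 1 `]-oo, x]).

End probability_notions.

Section one_group_prior.
Context {R : realType}.

Local Notation mu := lebesgue_measure.

Definition local_prior (K a : R) (L : R -> R) (t : R) : R :=
  K * t `^ (- a - 1) * L t.

(* [gauss_kernel tau x t] is, up to the factor (2 pi)^(-1/2), the density at x
   of N(0, 1 + t tau^2), the law of X_i given tau and lambda_i^2 = t. *)
Definition gauss_kernel (tau x t : R) : R :=
  (Num.sqrt (1 + t * tau ^+ 2))^-1
  * expR (- x ^+ 2 / (2 * (1 + t * tau ^+ 2))).

(* E(1 - kappa_i | X_i = x, tau), where kappa_i = 1 / (1 + lambda_i^2 tau^2) *)
Definition cond_shrinkage (a : R) (L : R -> R) (tau x : R) : R :=
  (\int[mu]_(t in `]0, +oo[)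
      (t * tau ^+ 2 / (1 + t * tau ^+ 2) * gauss_kernel tau x t
       * t `^ (- a - 1) * L t))
  / (\int[mu]_(t in `]0, +oo[)
      (gauss_kernel tau x t * t `^ (- a - 1) * L t)).

Definition marginal (K a : R) (L : R -> R) (tau x : R) : R :=
  \int[mu]_(t in `]0, +oo[)
     ((Num.sqrt (2 * pi * (1 + t * tau ^+ 2)))^-1
      * expR (- x ^+ 2 / (2 * (1 + t * tau ^+ 2)))
      * local_prior K a L t).

Definition posterior_weight (K a : R) (L pi2 : R -> R) (n : nat)
    (x : 'rV[R]_n) (tau : R) : R :=
  pi2 tau * \prod_(i < n) marginal K a L tau (x 0 i).

Definition posterior_tau (K a : R) (L pi2 : R -> R) (n : nat)
    (x : 'rV[R]_n) (tau : R) : R :=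
  posterior_weight K a L pi2 x tau
  / \int[mu]_(s in `]0, +oo[) posterior_weight K a L pi2 x s.

Definition full_bayes_shrinkage (K a : R) (L pi2 : R -> R) (alpha : R)
    (n : nat) (x : 'rV[R]_n) (i : 'I_n) : R :=
  \int[mu]_(tau in `[n%:R^-1, alpha])
     (cond_shrinkage a L tau (x 0 i) * posterior_tau K a L pi2 x tau).

Definition full_bayes_rule (K a : R) (L pi2 : R -> R) (alpha : R)
    (n : nat) (x : 'rV[R]_n) (i : 'I_n) : bool :=
  2^-1 < full_bayes_shrinkage K a L pi2 alpha x i.

End one_group_prior.

Section multiple_testing.
Context {R : realType}.

Definition supp (n : nat) (theta : 'rV[R]_n) : {set 'I_n} :=
  [set i | theta 0 i != 0]%SET.

Definition beta_min_class (n q : nat) (b : R) : set 'rV[R]_n :=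
  [set theta | #|supp theta| = q /\
     forall i, i \in supp theta ->
       Num.sqrt (2 * ln (n%:R / q%:R)) + b <= `|theta 0 i| ].

Context {d : measure_display} {T : measurableType d} (P : probability T R).
Context (n : nat) (eps : 'I_n -> {RV P >-> R}).

Definition observation (theta : 'rV[R]_n) (w : T) : 'rV[R]_n :=
  \row_i (theta 0 i + eps i w).

Variable psi : 'rV[R]_n -> 'I_n -> bool.

Definition FDR (theta : 'rV[R]_n) : \bar R :=
  'E_P[fun w =>
    (\sum_(i < n | theta 0 i == 0) (psi (observation theta w) i)%:R)
    / Num.max (\sum_(i < n) (psi (observation theta w) i)%:R) 1].

Definition FNR (theta : 'rV[R]_n) : \bar R :=
  'E_P[fun w =>
    (\sum_(i < n | theta 0 i != 0) (1 - (psi (observation theta w) i)%:R))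
    / Num.max #|supp theta|%:R 1].

Definition risk (theta : 'rV[R]_n) : \bar R := (FDR theta + FNR theta)%E.

Definition sup_risk (q : nat) (b : R) : \bar R :=
  ereal_sup (risk @` beta_min_class q b).

End multiple_testing.

(* Main.v *)
(**
Fix tau in [1/n, alpha_n] and split the posterior mass of a coordinate into
a spike part (weight kappa) and a slab part (weight 1 - kappa). The slab part
is at most a constant times tau, while the total mass is at least a constant
times exp(-x^2/2); hence E(1 - kappa | x, tau) <= A0 tau exp(x^2/2). Conversely
the slab part is at least of order tau/x^2, and the spike part is negligible
in front of it as soon as x^2 exp(-x^2/2) is a small multiple of tau. Averaging
over the posterior of tau, the full Bayes rule is therefore sandwiched between
two thresholding rules |X_i| > u_n and |X_i| >= v_n with
u_n, v_n = sqrt(2 log n) + o(1) = sqrt(2 log (n/q_n)) + o(1).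
By Mills' ratio the expected number of false discoveries is of order
n alpha_n / sqrt(log n) = (log n)^(delta3 - 1/2) -> 0, so FDR -> 0 uniformly,
while FNR is an average over the support of marginal miss probabilities,
each at most Phi(-b) + o(1) and equal to it up to o(1) when
theta_i = sqrt(2 log (n/q_n)) + b. Only the marginal laws of the noise enter,
and all expectations of the rule are compared with those of measurable
functions, so the rule itself need not be shown measurable in X.
*)
Require Import Defs.
From HB Require Import structures.
From mathcomp Require Import all_boot all_order all_algebra.
From mathcomp Require Import all_classical all_reals all_analysis.
From mathcomp Require Import measurable_realfun ring lra.

Import Order.TTheory GRing.Theory Num.Theory.
Import numFieldNormedType.Exports.

Local Open Scope classical_set_scope.
Local Open Scope ring_scope.

(** * Tail integrals *)

Section tail_integrals.
Context {R : realType}.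
Local Notation mu := (@lebesgue_measure R).

(** The improper integral of a nonnegative function is the limit of the increments of its
    antiderivative; as that limit is finite, integrability comes along with the value. *)
Lemma ge0_FTC_tail (f F : R -> R) (a l : R) :
  (forall x, a <= x -> 0 <= f x) ->
  (forall x, a <= x -> {for x, continuous f}) ->
  (forall x, a <= x -> is_derive x 1 F (f x)) ->
  F x @[x --> +oo] --> l ->
  mu.-integrable `[a, +oo[ (EFin \o f) /\
  \int[mu]_(x in `[a, +oo[) f x = l - F a.
Proof.
move=> f0 cf dF Fl.
have cfa : {within `[a, +oo[, continuous f}.
  apply: continuous_in_subspaceT => x; rewrite inE/= in_itv/= andbT => ax.
  exact: cf.
have dF1 x : a < x -> derivable F x 1.
  by move=> /ltW/dF Fx; exact: ex_derive.
have Fa : F x @[x --> a^'+] --> F a.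
  apply: cvg_at_right_filter; apply: differentiable_continuous.
  by apply/derivable1_diffP; have Fx := dF a (lexx a); exact: ex_derive.
have FE : {in `]a, +oo[, F^`()%classic =1 f}.
  move=> x; rewrite in_itv/= andbT => /ltW/dF Fx.
  by rewrite derive1E derive_val.
split; last by rewrite (Rintegral_ge0_continuous_FTC2y f0 cfa Fl dF1 Fa FE).
have mf : measurable_fun (`[a, +oo[ : set R) f.
  exact: subspace_continuous_measurable_fun.
apply/integrableP; split; first exact/measurable_EFinP.
under eq_integral => x.
  rewrite inE/= in_itv/= andbT => ax; rewrite /= ger0_norm ?f0//.
  over.
rewrite /=.
by rewrite (ge0_continuous_FTC2y f0 cfa Fl dF1 Fa FE) -EFinB ltry.
Qed.

Lemma cvg_sqrt_pinfty : Num.sqrt x @[x --> +oo] --> (+oo : set_system R).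
Proof.
apply/cvgryPge => A; near=> x.
have Ax : A ^+ 2 <= x by near: x; exact/nbhs_pinfty_ge/num_real.
by rewrite (le_trans (ler_norm A))// -sqrtr_sqr ler_wsqrtr.
Unshelve. all: by end_near. Qed.

(** The exponent is [- a - 1] at a = 1/2; the form in [Num.sqrt t] is the one that [field] can
    handle. *)
Lemma powR_minus32 (t : R) : 0 < t -> t `^ (- 2^-1 - 1) = (Num.sqrt t ^+ 3)^-1.
Proof.
move=> t0; rewrite powRD; last by rewrite (lt0r_neq0 t0) implybT.
rewrite powRN powR12_sqrt ?(ltW t0)// powR_inv1 ?(ltW t0)// -invfM.
by rewrite -[in X in _ * X](sqr_sqrtr (ltW t0)) -exprS.
Qed.

Lemma tail_pow32 (B : R) : 0 < B ->
  mu.-integrable `[B, +oo[ (EFin \o (fun t => t `^ (- 2^-1 - 1))) /\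
  \int[mu]_(t in `[B, +oo[) (t `^ (- 2^-1 - 1)) = 2 / Num.sqrt B.
Proof.
move=> B0.
have [||x Bx||i1 i2] := @ge0_FTC_tail (fun t => t `^ (- 2^-1 - 1))
    (fun t => - 2 * (Num.sqrt t)^-1) B 0.
- by move=> x _; exact: powR_ge0.
- move=> x Bx; have x0 : 0 < x by rewrite (lt_le_trans B0).
  apply: differentiable_continuous; apply/derivable1_diffP.
  by apply: derivable_powR; rewrite in_itv/= x0.
- have x0 : 0 < x by rewrite (lt_le_trans B0).
  have sx0 : 0 < Num.sqrt x by rewrite sqrtr_gt0.
  have dx := is_derive1_sqrt x0.
  have dV := @is_deriveV R Num.sqrt x _ 1 (lt0r_neq0 sx0) dx.
  apply: (@is_derive_eq _ _ _ _ _ _ _ _ (is_deriveZ (-2) dV)).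
  rewrite powR_minus32// /GRing.scale/=.
  by field; rewrite gt_eqF.
- rewrite -[X in _ --> X](mulr0 (-2)); apply: cvgMr.
  apply/gtr0_cvgV0; last exact: cvg_sqrt_pinfty.
  near=> x; rewrite sqrtr_gt0; near: x; exact/nbhs_pinfty_gt/num_real.
split => //; rewrite i2; field.
by rewrite gt_eqF// sqrtr_gt0.
Unshelve. all: by end_near. Qed.

(* [w] majorizes [t tau^2 / (1 + t tau^2) * t^(-3/2)], because
   [(1 + r)^2 <= 2 (1 + r^2)], and has antiderivative
   [- 4 tau / (1 + tau sqrt t)]. *)
Lemma tail_slab (tau : R) : 0 < tau ->
  let w t := 2 * tau ^+ 2 / (Num.sqrt t * (1 + tau * Num.sqrt t) ^+ 2) in
  mu.-integrable `[1, +oo[ (EFin \o w) /\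
  \int[mu]_(t in `[1, +oo[) w t <= 4 * tau.
Proof.
move=> tau0 w.
have s0 (x : R) : 1 <= x -> 0 < Num.sqrt x.
  by move=> x1; rewrite sqrtr_gt0 (lt_le_trans ltr01).
have v0 (x : R) : 0 < 1 + tau * Num.sqrt x.
  by rewrite ltr_wpDr// mulr_ge0 ?sqrtr_ge0// ltW.
have [x x1|x x1|x x1||i1 i2] := @ge0_FTC_tail w
    (fun t => - (4 * tau) * (1 + tau * Num.sqrt t)^-1) 1 0.
- by rewrite divr_ge0// mulr_ge0 ?sqr_ge0 ?sqrtr_ge0.
- rewrite /w; apply: cvgMr; apply: cvgV.
    by rewrite mulf_neq0 ?expf_neq0// ?gt_eqF// ?s0// ltW.
  have cs : {for x, continuous (@Num.sqrt R)} by exact: sqrt_continuous.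
  apply: cvgM => //; rewrite expr2.
  under eq_fun do rewrite expr2.
  by apply: cvgM; (apply: cvgD; first exact: cvg_cst); apply: cvgMr.
- have x0 : 0 < x by rewrite (lt_le_trans ltr01).
  have dx := is_derive1_sqrt x0.
  have dZ := is_deriveZ tau dx.
  have d1 := is_deriveD (is_derive_cst (1 : R) x 1) dZ.
  have dV := @is_deriveV R _ x _ 1 (lt0r_neq0 (v0 x)) d1.
  apply: (@is_derive_eq _ _ _ _ _ _ _ _ (is_deriveZ (- (4 * tau)) dV)).
  rewrite /w /GRing.scale/= ?fctE.
  have -> : (tau \*: @Num.sqrt R) x = tau * Num.sqrt x by [].
  by field; rewrite !gt_eqF ?s0.
- rewrite -[X in _ --> X](mulr0 (- (4 * tau))); apply: cvgMr.
  apply/gtr0_cvgV0; first by near=> x; exact: v0.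
  apply/cvgryPge => A; near=> x.
  rewrite (@le_trans _ _ (tau * Num.sqrt x))//; last by rewrite lerDr.
  rewrite -ler_pdivrMl//.
  near: x; move: (cvg_sqrt_pinfty) => /cvgryPge; exact.
split => //; rewrite i2 sub0r mulNr opprK sqrtr1 mulr1.
by rewrite ler_piMr ?mulr_ge0 ?ltW// invf_lt1 ?ltrDl// addr_gt0.
Unshelve. all: by end_near. Qed.

End tail_integrals.

(** * Shrinkage for a fixed global scale *)

(* The integral of a nonnegative function is a supremum over the simple
   functions below it: measurability plays no role in its monotonicity. *)
Lemma ge0_le_integral_nomeas d (T : measurableType d) (R : realType)
    (mu : {measure set T -> \bar R}) (A : set T) (f g : T -> \bar R) :
  (forall x, A x -> (0 <= f x)%E) -> (forall x, A x -> (f x <= g x)%E) ->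
  (\int[mu]_(x in A) f x <= \int[mu]_(x in A) g x)%E.
Proof.
move=> f0 fg; rewrite !ge0_integralE//; last first.
  by move=> x Ax; rewrite (le_trans (f0 x Ax) (fg x Ax)).
apply: le_ereal_sup => _ [h /= hf <-]; exists h => // x.
by rewrite (le_trans (hf x))//; exact: lee_restrict.
Qed.

(** The prior density of lambda^2 at a = 1/2, stripped of its normalizing constant [K]. *)
Definition slab_weight {R : realType} (L : R -> R) (t : R) : R :=
  t `^ (- 2^-1 - 1) * L t.

Section polynomial_prior.
Context {R : realType} (K M c0 t0 : R) (L : R -> R).
Local Notation mu := (@lebesgue_measure R).
Local Notation D := (`]0, +oo[%classic : set R).
Hypothesis K_gt0 : 0 < K.
Hypothesis pi1_density : prob_density_pos (local_prior K 2^-1 L).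
Hypothesis mL : measurable_fun D L.
Hypothesis L_gt0 : forall t, 0 < t -> 0 < L t.
Hypothesis L_le : forall t, 0 < t -> L t <= M.
Hypothesis c0_gt0 : 0 < c0.
Hypothesis t0_gt0 : 0 < t0.
Hypothesis L_ge : forall t, t0 <= t -> c0 <= L t.

Local Notation rho := (slab_weight L).

(** * Integration against the prior density *)

Lemma itv0yE (t : R) : D t <-> 0 < t.
Proof. by rewrite /= in_itv/= andbT. Qed.

Lemma rho_ge0 t : 0 < t -> 0 <= rho t.
Proof. by move=> t0'; rewrite /slab_weight mulr_ge0 ?powR_ge0// ltW// L_gt0. Qed.

Lemma measurable_rho : measurable_fun D rho.
Proof.
apply: measurable_funM => //; apply: measurable_funTS; exact: measurable_powR.
Qed.

Lemma integrable_rho : mu.-integrable D (EFin \o rho).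
Proof.
apply/integrableP; split; first by apply/measurable_EFinP; exact: measurable_rho.
have [_ _ int1] := pi1_density.
have -> : (\int[mu]_(t in D) `|(EFin \o rho) t| =
    \int[mu]_(t in D) (K^-1%:E * (local_prior K 2^-1 L t)%:E))%E.
  apply: eq_integral => t; rewrite inE => /itv0yE t_gt0.
  rewrite /= ger0_norm ?rho_ge0// -EFinM /local_prior /slab_weight; congr EFin.
  by rewrite !mulrA mulVf ?mul1r// gt_eqF.
rewrite ge0_integralZl_EFin//.
- by rewrite int1 mule1 ltry.
- move=> t /itv0yE t_gt0; rewrite lee_fin /local_prior -mulrA mulr_ge0 ?ltW//.
  by rewrite mulr_gt0 ?powR_gt0 ?L_gt0.
- apply/measurable_EFinP; by case: pi1_density.
- by rewrite invr_ge0 ltW.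
Qed.

Lemma integrable_rhoZ (r : R) : mu.-integrable D (EFin \o (fun t => r * rho t)).
Proof.
have mD : measurable (D : set (measurableTypeR R)) by [].
exact: (integrableZl mD r integrable_rho).
Qed.

Lemma Rintegral_rho : \int[mu]_(t in D) rho t = K^-1.
Proof.
have [_ _ int1] := pi1_density.
apply: (mulfI (lt0r_neq0 K_gt0)); rewrite mulfV ?gt_eqF//.
rewrite -RintegralZl//; last exact: integrable_rho.
rewrite /Rintegral -[RHS]/(fine 1%E) -int1; congr fine.
by apply: eq_integral => t _; rewrite /local_prior /slab_weight mulrA.
Qed.

Lemma integrable_mul_rho (h : R -> R) C : measurable_fun D h ->
  (forall t, 0 < t -> 0 <= h t <= C) ->
  mu.-integrable D (EFin \o (fun t => h t * rho t)).
Proof.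
move=> mh hC.
have mD : measurable (D : set (measurableTypeR R)) by [].
apply: (le_integrable mD _ _ (integrable_rhoZ C)).
- by apply/measurable_EFinP; apply: measurable_funM => //; exact: measurable_rho.
- move=> t /itv0yE t_gt0; have /andP[h0 h1] := hC t t_gt0.
  have r0 := rho_ge0 t t_gt0.
  rewrite /= lee_fin (ger0_norm (mulr_ge0 h0 r0)).
  by rewrite (ger0_norm (mulr_ge0 (le_trans h0 h1) r0)) ler_wpM2r.
Qed.

(** Near 0 the power t^(-3/2) is not integrable, so an upper bound on [L] alone cannot control that
    region; the total mass 1/K of [rho] does. Beyond [B] an explicit integrable majorant takes
    over. *)
Lemma split_integral_le (f g : R -> R) (a B : R) : 0 <= a -> 0 < B ->
  mu.-integrable D (EFin \o f) ->
  (forall t, 0 < t -> t < B -> f t <= a * rho t) ->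
  mu.-integrable `[B, +oo[ (EFin \o g) ->
  (forall t, B <= t -> f t <= g t) ->
  \int[mu]_(t in D) f t <= a / K + \int[mu]_(t in `[B, +oo[) g t.
Proof.
move=> a0 B0 intf fa intg fg.
have DE : D = `]0, B[ `|` `[B, +oo[.
  by rewrite -itv_bndbnd_setU// bnd_simp.
have s1 : `]0, B[ `<=` D by rewrite DE; exact: subsetUl.
have s2 : `[B, +oo[ `<=` D by rewrite DE; exact: subsetUr.
rewrite [in leLHS]DE Rintegral_setU//; last 2 first.
- by rewrite -DE.
- apply/disj_setPS => t [] /=; rewrite !in_itv/= andbT => /andP[_ tB] Bt.
  by have := lt_le_trans tB Bt; rewrite ltxx.
rewrite lerD//.
- apply: (@le_trans _ _ (\int[mu]_(t in `]0, B[) (a * rho t))).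
    apply: le_Rintegral => //.
    + exact: integrableS intf.
    + exact: integrableS (integrable_rhoZ a).
    + by move=> t; rewrite /= in_itv/= => /andP[]; exact: fa.
  rewrite RintegralZl//; last by apply: integrableS integrable_rho.
  rewrite ler_wpM2l// -Rintegral_rho [in leRHS]DE Rintegral_setU//.
  + rewrite lerDl; apply: Rintegral_ge0 => t.
    by rewrite /= in_itv/= andbT => Bt; rewrite rho_ge0// (lt_le_trans B0).
  + by rewrite -DE; exact: integrable_rho.
  + apply/disj_setPS => t [] /=; rewrite !in_itv/= andbT => /andP[_ tB] Bt.
    by have := lt_le_trans tB Bt; rewrite ltxx.
- apply: le_Rintegral => //.
  + exact: integrableS intf.
  + by move=> t; rewrite /= in_itv/= andbT; exact: fg.
Qed.

(** Keep only [a, b]: the power of t is decreasing, hence smallest at [b], and [L] is at least [c0]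
    there because [a] is beyond [t0]. *)
Lemma local_integral_ge (h : R -> R) (m a b : R) : t0 <= a -> a <= b ->
  0 <= m -> mu.-integrable D (EFin \o (fun t => h t * rho t)) ->
  (forall t, 0 < t -> 0 <= h t) ->
  (forall t, a <= t <= b -> m <= h t) ->
  m * (c0 * b `^ (- 2^-1 - 1)) * (b - a) <= \int[mu]_(t in D) (h t * rho t).
Proof.
move=> t0a ab m0 inth h0 hm.
have a0 : 0 < a by exact: lt_le_trans t0a.
have sub : `[a, b] `<=` D.
  by move=> t; rewrite /= !in_itv/= andbT => /andP[at_ _]; exact: lt_le_trans at_.
have -> : b - a = fine (mu `[a, b]).
  rewrite lebesgue_measure_itv/= lte_fin.
  by case: ltgtP ab => //= -> _; rewrite subrr.
rewrite -Rintegral_cst//.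
apply: (@le_trans _ _ (\int[mu]_(t in `[a, b]) (h t * rho t))).
  apply: le_Rintegral => //.
  - apply: measurable_bounded_integrable => //.
      by rewrite /= lebesgue_measure_itv/= lte_fin; case: ifP => _ //; rewrite -EFinD ltry.
    exact: bounded_cst.
  - exact: integrableS inth.
  - move=> t; rewrite /= in_itv/= => /andP[at_ tb].
    have t_gt0 := lt_le_trans a0 at_.
    apply: ler_pM => //; first by rewrite mulr_ge0 ?powR_ge0 ?ltW.
      by apply: hm; rewrite at_.
    rewrite /slab_weight mulrC ler_pM ?powR_ge0 ?(ltW c0_gt0)//.
      rewrite !powR_minus32//; last by rewrite (lt_le_trans t_gt0).
      rewrite lef_pV2 ?posrE ?exprn_gt0 ?sqrtr_gt0//; last by rewrite (lt_le_trans t_gt0).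
      by rewrite lerXn2r ?nnegrE ?sqrtr_ge0// ler_wsqrtr.
    by rewrite L_ge// (le_trans t0a).
rewrite /Rintegral fine_le//.
- apply: integrable_fin_num => //; exact: integrableS inth.
- exact: integrable_fin_num.
- apply: ge0_subset_integral => //; first exact: measurable_int inth.
  move=> t /itv0yE t_gt0; rewrite lee_fin.
  exact: mulr_ge0 (h0 t t_gt0) (rho_ge0 t t_gt0).
Qed.


(** * The Gaussian kernel and its spike and slab parts *)

Lemma gauss_kernel_powR (tau x t : R) : 0 <= t ->
  gauss_kernel tau x t = (1 + t * tau ^+ 2) `^ (- 2^-1)
    * expR (- x ^+ 2 / 2 * (1 + t * tau ^+ 2) `^ (- 1)).
Proof.
move=> t_ge0; have v0 : 0 <= 1 + t * tau ^+ 2.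
  by rewrite addr_ge0// mulr_ge0// sqr_ge0.
rewrite /gauss_kernel powRN powR12_sqrt// powR_inv1//.
by congr (_ * expR _); rewrite invfM mulrA.
Qed.

Lemma slab_var_gt0 (tau t : R) : 0 < t -> 0 < 1 + t * tau ^+ 2.
Proof. by move=> t_gt0; rewrite ltr_wpDr// mulr_ge0 ?sqr_ge0 ?ltW. Qed.

Lemma gauss_kernel_ge0 (tau x t : R) : 0 <= gauss_kernel tau x t.
Proof. by rewrite mulr_ge0 ?invr_ge0 ?sqrtr_ge0 ?expR_ge0. Qed.

Lemma gauss_kernel_le1 (tau x t : R) : 0 < t -> gauss_kernel tau x t <= 1.
Proof.
move=> t_gt0; have v0 := slab_var_gt0 tau t t_gt0.
rewrite /gauss_kernel mulr_ile1 ?invr_ge0 ?sqrtr_ge0 ?expR_ge0//.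
  rewrite invf_le1 ?sqrtr_gt0// -[leLHS]sqrtr1 ler_wsqrtr// lerDl.
  by rewrite mulr_ge0 ?sqr_ge0 ?ltW.
by rewrite expR_le1 mulNr oppr_le0 divr_ge0 ?sqr_ge0// mulr_ge0 ?ltW.
Qed.

(** The inverse and the inverse square root of the variance are both treated as powers of it, so
    that measurability of [powR] covers them together. *)
Lemma measurable_slab_var (tau p : R) :
  measurable_fun D (fun t => (1 + t * tau ^+ 2) `^ p).
Proof.
apply: measurable_funTS.
apply: (@measurableT_comp _ _ _ _ _ _ (@powR R ^~ p)); first exact: measurable_powR.
apply: measurable_funD => //; exact: measurable_funM.
Qed.

Lemma measurable_gauss_kernel (tau x : R) : measurable_fun D (gauss_kernel tau x).
Proof.
apply: (@eq_measurable_fun _ _ (measurableTypeR R) (measurableTypeR R) D (fun t => (1 + t * tau ^+ 2) `^ (- 2^-1)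
    * expR (- x ^+ 2 / 2 * (1 + t * tau ^+ 2) `^ (- 1)))).
  by move=> t; rewrite inE => /itv0yE t_gt0; rewrite gauss_kernel_powR ?ltW.
apply: measurable_funM; first exact: measurable_slab_var.
apply: measurableT_comp => //; apply: measurable_funM => //.
exact: measurable_slab_var.
Qed.

Lemma slab_var_inv_itv (tau t : R) : 0 < t -> 0 <= (1 + t * tau ^+ 2)^-1 <= 1.
Proof.
move=> t_gt0; have v0 := slab_var_gt0 tau t t_gt0.
rewrite invr_ge0 ltW//= invf_le1// lerDl.
by rewrite mulr_ge0 ?sqr_ge0 ?ltW.
Qed.

Lemma slab_ratioE (tau t : R) : 0 < t ->
  t * tau ^+ 2 / (1 + t * tau ^+ 2) = 1 - (1 + t * tau ^+ 2)^-1.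
Proof. by move=> /(slab_var_gt0 tau) v0; field; rewrite gt_eqF. Qed.

Let spike_part tau x := \int[mu]_(t in D)
  ((1 + t * tau ^+ 2)^-1 * gauss_kernel tau x t * rho t).
Let slab_part tau x := \int[mu]_(t in D)
  (t * tau ^+ 2 / (1 + t * tau ^+ 2) * gauss_kernel tau x t * rho t).

Lemma integrable_kernel (tau x : R) :
  mu.-integrable D (EFin \o (fun t => gauss_kernel tau x t * rho t)).
Proof.
apply: (integrable_mul_rho _ 1); first exact: measurable_gauss_kernel.
by move=> t t_gt0; rewrite gauss_kernel_ge0 gauss_kernel_le1.
Qed.

Lemma integrable_spike (tau x : R) : mu.-integrable D
  (EFin \o (fun t => (1 + t * tau ^+ 2)^-1 * gauss_kernel tau x t * rho t)).
Proof.
apply: (integrable_mul_rho _ 1).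
  apply: measurable_funM; last exact: measurable_gauss_kernel.
  apply: (@eq_measurable_fun _ _ (measurableTypeR R) (measurableTypeR R) D (fun t => (1 + t * tau ^+ 2) `^ (-1))).
    move=> t; rewrite inE => /itv0yE /(slab_var_gt0 tau) v0.
    by rewrite powR_inv1 ?ltW.
  exact: measurable_slab_var.
move=> t t_gt0; have /andP[i0 i1] := slab_var_inv_itv tau t t_gt0.
by rewrite mulr_ge0 ?gauss_kernel_ge0// mulr_ile1 ?gauss_kernel_ge0 ?gauss_kernel_le1.
Qed.

Lemma integrable_slab (tau x : R) : mu.-integrable D
  (EFin \o (fun t => t * tau ^+ 2 / (1 + t * tau ^+ 2) * gauss_kernel tau x t * rho t)).
Proof.
apply: (integrable_mul_rho _ 1).
  apply: measurable_funM; last exact: measurable_gauss_kernel.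
  apply: (@eq_measurable_fun _ _ (measurableTypeR R) (measurableTypeR R) D (fun t => 1 - (1 + t * tau ^+ 2) `^ (-1))).
    move=> t; rewrite inE => /itv0yE t_gt0; have v0 := slab_var_gt0 tau t t_gt0.
    by rewrite powR_inv1 ?ltW// slab_ratioE.
  apply: measurable_funB => //; exact: measurable_slab_var.
move=> t t_gt0; have /andP[i0 i1] := slab_var_inv_itv tau t t_gt0.
have r0 : 0 <= t * tau ^+ 2 / (1 + t * tau ^+ 2) by rewrite slab_ratioE// subr_ge0.
rewrite mulr_ge0 ?gauss_kernel_ge0// mulr_ile1 ?gauss_kernel_ge0 ?gauss_kernel_le1//.
by rewrite slab_ratioE// gerDl oppr_le0.
Qed.

Lemma spike_part_ge0 tau x : 0 <= spike_part tau x.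
Proof.
apply: Rintegral_ge0 => t /itv0yE t_gt0; have /andP[i0 _] := slab_var_inv_itv tau t t_gt0.
apply: mulr_ge0; last exact: rho_ge0.
by apply: mulr_ge0 => //; exact: gauss_kernel_ge0.
Qed.

Lemma slab_part_ge0 tau x : 0 <= slab_part tau x.
Proof.
apply: Rintegral_ge0 => t /itv0yE t_gt0; have /andP[_ i1] := slab_var_inv_itv tau t t_gt0.
apply: mulr_ge0; last exact: rho_ge0.
by rewrite slab_ratioE// mulr_ge0 ?subr_ge0 ?gauss_kernel_ge0.
Qed.

Lemma kernel_splitE tau x :
  \int[mu]_(t in D) (gauss_kernel tau x t * rho t) = slab_part tau x + spike_part tau x.
Proof.
rewrite /slab_part /spike_part -RintegralD//.
- apply: eq_Rintegral => t; rewrite inE => /itv0yE t_gt0.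
  by rewrite slab_ratioE// -!mulrDl subrK mul1r.
- exact: integrable_slab.
- exact: integrable_spike.
Qed.

Lemma cond_shrinkageE tau x : cond_shrinkage 2^-1 L tau x =
  slab_part tau x / (\int[mu]_(t in D) (gauss_kernel tau x t * rho t)).
Proof.
by rewrite /cond_shrinkage; congr (_ / _); apply: eq_Rintegral => t _;
  rewrite /slab_weight !mulrA.
Qed.

(** * Conditional shrinkage at small and large observations *)

Lemma cond_shrinkage_ge0 tau x : 0 <= cond_shrinkage 2^-1 L tau x.
Proof.
rewrite cond_shrinkageE kernel_splitE divr_ge0 ?addr_ge0 ?slab_part_ge0//.
exact: spike_part_ge0.
Qed.

Lemma cond_shrinkage_le1 tau x : cond_shrinkage 2^-1 L tau x <= 1.
Proof.
rewrite cond_shrinkageE kernel_splitE.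
have s0 := slab_part_ge0 tau x; have p0 := spike_part_ge0 tau x.
(* If the denominator vanishes, the quotient is 0 by convention, which still satisfies the bound. *)
have [->|n0] := eqVneq (slab_part tau x + spike_part tau x) 0.
  by rewrite invr0 mulr0.
by rewrite ler_pdivrMr ?mul1r ?lerDl// lt_def n0 addr_ge0.
Qed.

(** Below t = 1 the weight 1 - kappa is at most tau^2, hence at most tau, and the mass is at most
    1/K. Above it the kernel is at most 1, [L] is at most [M], and the majorant of [tail_slab]
    integrates to at most 4 tau. *)
Lemma slab_part_le tau x : 0 < tau <= 1 ->
  slab_part tau x <= tau * (K^-1 + 4 * M).
Proof.
move=> /andP[tau0 tau1].
have [iw wle] := tail_slab tau tau0.
have M_gt0 : 0 < M by exact: lt_le_trans (L_gt0 1 ltr01) (L_le 1 ltr01).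
set w := (X in EFin \o X) in iw wle.
have mB : measurable (`[1, +oo[ : set (measurableTypeR R)) by [].
have iMw : mu.-integrable `[1, +oo[ (EFin \o (fun t => M * w t)).
  exact: (integrableZl mB M iw).
apply: (@le_trans _ _ (tau / K + \int[mu]_(t in `[1, +oo[) (M * w t))).
  apply: split_integral_le => //; first exact: ltW.
  - exact: integrable_slab.
  - move=> t t_gt0 t_lt1; have v0 := slab_var_gt0 tau t t_gt0.
    apply: ler_wpM2r; first exact: rho_ge0.
    rewrite -[leRHS]mulr1 ler_pM ?gauss_kernel_ge0 ?gauss_kernel_le1//.
      by rewrite divr_ge0 ?mulr_ge0 ?sqr_ge0 ?ltW.
    rewrite ler_pdivrMr// (@le_trans _ _ (tau ^+ 2))//.
      by rewrite ler_piMl ?sqr_ge0 ?ltW.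
    rewrite (@le_trans _ _ tau)//; first by rewrite expr2 ler_piMl ?(ltW tau0).
    by rewrite ler_peMr ?ltW// ltrDl mulr_gt0 ?exprn_gt0.
  - move=> t t_ge1; have t_gt0 : 0 < t by rewrite (lt_le_trans ltr01).
    have v0 := slab_var_gt0 tau t t_gt0.
    have st : 0 < Num.sqrt t by rewrite sqrtr_gt0.
    rewrite /slab_weight [_ * L t]mulrC mulrCA.
    apply: ler_pM; rewrite ?L_le ?(ltW (L_gt0 _ t_gt0))//.
      rewrite mulr_ge0 ?powR_ge0// mulr_ge0 ?gauss_kernel_ge0//.
      by rewrite divr_ge0 ?mulr_ge0 ?sqr_ge0 ?ltW.
    apply: (@le_trans _ _ (t * tau ^+ 2 / (1 + t * tau ^+ 2) * t `^ (- 2^-1 - 1))).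
      rewrite ler_wpM2r ?powR_ge0// ler_piMr ?gauss_kernel_le1//.
      by rewrite divr_ge0 ?mulr_ge0 ?sqr_ge0 ?ltW.
    rewrite powR_minus32// /w; move: v0; rewrite -(sqr_sqrtr (ltW t_gt0)).
    set s := Num.sqrt t in st *; rewrite sqrtr_sqr (gtr0_norm st) => v0.
    have -> : s ^+ 2 * tau ^+ 2 / (1 + s ^+ 2 * tau ^+ 2) / s ^+ 3 =
        tau ^+ 2 / s * (1 + s ^+ 2 * tau ^+ 2)^-1.
      by field; rewrite exprMn !gt_eqF.
    have w0 : 0 < 1 + tau * s by rewrite addr_gt0 ?mulr_gt0.
    have -> : 2 * tau ^+ 2 / (s * (1 + tau * s) ^+ 2) =
        tau ^+ 2 / s * (2 / (1 + tau * s) ^+ 2) by field; rewrite !gt_eqF.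
    apply: ler_wpM2l; first by rewrite divr_ge0 ?sqr_ge0 ?(ltW st).
    rewrite -(ler_pM2r v0) mulVf ?gt_eqF// mulrAC.
    rewrite ler_pdivlMr ?exprn_gt0// mul1r.
    have := sqr_ge0 (1 - tau * s); nra.
rewrite RintegralZl// mulrDr lerD2l.
apply: le_trans (ler_wpM2l (ltW M_gt0) wle) _.
by rewrite le_eqVlt; apply/orP; left; apply/eqP; ring.
Qed.

(** The interval [t0, t0 + 1] has length 1 and does not depend on [tau]. On it the variance 1 + t
    tau^2 lies between 1 and 2 + t0: the lower end serves the exponential, the upper end the square
    root. *)
Lemma kernel_integral_ge : exists2 d0, 0 < d0 & forall tau x, 0 < tau <= 1 ->
  d0 * expR (- x ^+ 2 / 2) <= \int[mu]_(t in D) (gauss_kernel tau x t * rho t).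
Proof.
pose b := t0 + 1; have b_gt0 : 0 < b by rewrite addr_gt0.
exists ((Num.sqrt (1 + b))^-1 * (c0 * b `^ (- 2^-1 - 1))).
  by rewrite !mulr_gt0 ?powR_gt0// invr_gt0 sqrtr_gt0 addr_gt0.
move=> tau x /andP[tau0 tau1].
pose e := expR (- x ^+ 2 / 2).
apply: le_trans (local_integral_ge (gauss_kernel tau x)
    ((Num.sqrt (1 + b))^-1 * e) t0 b _ _ _ _ _ _) => //.
- by rewrite /b addrAC subrr add0r mulr1 [leRHS]mulrAC.
- by rewrite lerDl.
- by rewrite mulr_ge0 ?invr_ge0 ?sqrtr_ge0 ?expR_ge0.
- exact: integrable_kernel.
- by move=> t _; exact: gauss_kernel_ge0.
- move=> t /andP[t0t tb]; have t_gt0 : 0 < t by exact: lt_le_trans t0t.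
  have v0 := slab_var_gt0 tau t t_gt0.
  have tau2 : tau ^+ 2 <= 1 by rewrite expr_le1// ltW.
  rewrite ler_pM ?invr_ge0 ?sqrtr_ge0 ?expR_ge0//.
    have sb : 0 < 1 + b by rewrite addr_gt0.
    rewrite lef_pV2 ?posrE ?sqrtr_gt0// ler_wsqrtr// lerD2l.
    by rewrite (le_trans _ tb)// ler_piMr// ltW.
  rewrite ler_expR !mulNr lerN2 ler_wpM2l ?sqr_ge0//.
  rewrite lef_pV2 ?posrE ?mulr_gt0// ler_peMr// lerDl.
  by rewrite mulr_ge0 ?sqr_ge0 ?ltW.
Qed.

Lemma cond_shrinkage_small : exists2 A0, 0 < A0 &
  forall tau x, 0 < tau <= 1 ->
    cond_shrinkage 2^-1 L tau x <= A0 * tau * expR (x ^+ 2 / 2).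
Proof.
have M_gt0 : 0 < M by exact: lt_le_trans (L_gt0 1 ltr01) (L_le 1 ltr01).
have [d0 d0_gt0 d0_le] := kernel_integral_ge.
(* Ratio of the constants of [slab_part_le] and [kernel_integral_ge]. *)
exists ((K^-1 + 4 * M) / d0).
  by rewrite divr_gt0// addr_gt0 ?invr_gt0// mulr_gt0.
move=> tau x tau01; have /andP[tau0 tau1] := tau01.
pose e := expR (- x ^+ 2 / 2).
have den := d0_le tau x tau01.
have e_gt0 : 0 < e by exact: expR_gt0.
have de_gt0 : 0 < d0 * e by exact: mulr_gt0.
have I_gt0 := lt_le_trans de_gt0 den.
rewrite cond_shrinkageE ler_pdivrMr// (le_trans (slab_part_le tau x tau01))//.
have -> : expR (x ^+ 2 / 2) = e^-1 by rewrite /e mulNr expRN invrK.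
apply: (@le_trans _ _ ((K^-1 + 4 * M) / d0 * tau / e * (d0 * e))).
  rewrite le_eqVlt; apply/orP; left; apply/eqP.
  by field; rewrite !gt_eqF.
rewrite ler_wpM2l// !mulr_ge0 ?invr_ge0 ?(ltW tau0) ?(ltW e_gt0) ?(ltW d0_gt0)//.
by rewrite addr_ge0 ?mulr_ge0 ?invr_ge0 ?ltW.
Qed.

(** With r^2 the variance 1 + t tau^2, the left side is kappa times the kernel at y, and the bound
    is free of t. In terms of s = y/r it reads s^3 <= 3 exp(s^2/2), which follows from exp z >= 1 +
    z^2/2. *)
Lemma cube_expR_le (y r : R) : 0 < y -> 0 < r ->
  (r ^+ 3)^-1 * expR (- y ^+ 2 / (2 * r ^+ 2)) <= 3 / y ^+ 3.
Proof.
move=> y0 r0; pose s := y / r; have s0 : 0 < s by rewrite divr_gt0.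
have -> : - y ^+ 2 / (2 * r ^+ 2) = - (s ^+ 2 / 2).
  by rewrite /s; field; rewrite gt_eqF.
have e2 : 1 + (s ^+ 2 / 2) ^+ 2 / 2 <= expR (s ^+ 2 / 2).
  apply: (expR_ge1Dxn 1); rewrite divr_ge0 ?sqr_ge0//.
rewrite expRN ler_pdivlMr ?exprn_gt0//.
have -> : (r ^+ 3)^-1 / expR (s ^+ 2 / 2) * y ^+ 3 = s ^+ 3 / expR (s ^+ 2 / 2).
  by rewrite /s; field; rewrite !gt_eqF ?expR_gt0.
rewrite ler_pdivrMr ?expR_gt0//.
have : s ^+ 3 <= 3 * (1 + (s ^+ 2 / 2) ^+ 2 / 2).
  have := sqr_ge0 (s * (s - 2)); have := sqr_ge0 (s ^+ 2 - 4); lra.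
by move=> /le_trans; apply; rewrite ler_pM2l.
Qed.

(* Only [x^2 <= t tau^2 <= 4 x^2] is kept from the integral. *)
Lemma slab_part_ge (tau x : R) : 0 < tau <= 1 -> 1 <= `|x| -> t0 <= x ^+ 2 ->
  c0 * tau / (32 * x ^+ 2) <= slab_part tau x.
Proof.
move=> /andP[tau0 tau1] x1 xt0; rewrite -(real_normK (num_real x)).
set y := `|x| in x1 *; have y0 : 0 < y by exact: lt_le_trans x1.
have xy : x ^+ 2 = y ^+ 2 by rewrite real_normK ?num_real.
have yt0 : 0 < y / tau by rewrite divr_gt0.
have h_ge0 t : 0 < t -> 0 <= t * tau ^+ 2 / (1 + t * tau ^+ 2) * gauss_kernel tau x t.
  move=> t_gt0; have v0 := slab_var_gt0 tau t t_gt0.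
  by rewrite mulr_ge0 ?gauss_kernel_ge0// divr_ge0 ?mulr_ge0 ?sqr_ge0 ?ltW.
apply: le_trans (local_integral_ge _ (12 * y)^-1 ((y / tau) ^+ 2)
  ((2 * (y / tau)) ^+ 2) _ _ _ (integrable_slab tau x) h_ge0 _).
- rewrite powR_minus32; last by rewrite exprn_gt0// mulr_gt0.
  rewrite sqrtr_sqr ger0_norm; last by rewrite mulr_ge0// ltW.
  rewrite le_eqVlt; apply/orP; left; apply/eqP.
  by field; rewrite !gt_eqF.
- rewrite (le_trans xt0)// xy ler_pXn2r ?nnegrE ?(ltW y0) ?(ltW yt0)//.
  by rewrite ler_peMr ?(ltW y0)// invf_ge1.
- by rewrite [leRHS]exprMn ler_peMl ?sqr_ge0// -natrX ler1n.
- by rewrite invr_ge0 mulr_ge0 ?(ltW y0).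
- move=> t /andP[ta tb].
  have tau2 : 0 < tau ^+ 2 by rewrite exprn_gt0.
  have ua : y ^+ 2 <= t * tau ^+ 2.
    by move: ta; rewrite expr_div_n ler_pdivrMr.
  have ub : t * tau ^+ 2 <= 4 * y ^+ 2.
    move: tb; rewrite exprMn expr_div_n mulrA ler_pdivlMr// => /le_trans; apply.
    by rewrite -natrX.
  rewrite /gauss_kernel; set u := t * tau ^+ 2 in ua ub *.
  have y2 : 1 <= y ^+ 2 by rewrite exprn_ege1.
  have u1 : 1 <= u by exact: le_trans ua.
  have u0 : 0 < 1 + u by rewrite addr_gt0// (lt_le_trans ltr01).
  (* One factor each for the weight 1 - kappa (as u >= 1), the square root (as 1 + u <= 9 y^2) and
     the exponential (its exponent is at least -1/2 because y^2 <= u, so its value is at least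
     1/2). *)
  have -> : (12 * y)^-1 = 2^-1 * ((3 * y)^-1 * 2^-1) by field; rewrite gt_eqF.
  apply: ler_pM; rewrite ?invr_ge0 ?mulr_ge0 ?invr_ge0 ?(ltW y0) ?mulr_ge0 ?(ltW y0)//.
    rewrite ler_pdivlMr//; lra.
  apply: ler_pM; rewrite ?invr_ge0 ?mulr_ge0 ?(ltW y0)//.
    rewrite lef_pV2 ?posrE ?mulr_gt0 ?sqrtr_gt0//.
    rewrite -[leRHS]ger0_norm ?mulr_ge0 ?(ltW y0)// -sqrtr_sqr ler_wsqrtr//.
    rewrite exprMn; lra.
  apply: le_trans (expR_ge1Dx _).
  rewrite xy mulNr.
  have : y ^+ 2 / (2 * (1 + u)) <= 2^-1.
    rewrite ler_pdivrMr ?mulr_gt0//; lra.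
  set z := _ / _; lra.
Qed.

(* Splitting at [t tau^2 = S^2 / x^2]: the exponential gains at most
   [exp (S^2 / 2)] below that point, and the decay in [t] wins above it. *)
Lemma spike_part_le (tau x S : R) : 0 < tau -> 0 < `|x| -> 0 < S ->
  spike_part tau x <=
    expR (S ^+ 2 / 2 - x ^+ 2 / 2) / K + 6 * M * tau / (x ^+ 2 * S).
Proof.
move=> tau0 y0 S0; set y := `|x| in y0.
have xy : x ^+ 2 = y ^+ 2 by rewrite real_normK ?num_real.
have M_gt0 : 0 < M by exact: lt_le_trans (L_gt0 1 ltr01) (L_le 1 ltr01).
pose B := (S / (y * tau)) ^+ 2.
have q0 : 0 < S / (y * tau) by rewrite divr_gt0 ?mulr_gt0.
have B0 : 0 < B by rewrite exprn_gt0.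
have [ip pE] := tail_pow32 B B0.
have mB : measurable (`[B, +oo[ : set (measurableTypeR R)) by [].
pose C := 3 * M / y ^+ 3.
have C0 : 0 <= C by rewrite divr_ge0 ?mulr_ge0 ?exprn_ge0 ?(ltW M_gt0) ?(ltW y0).
have iCp : mu.-integrable `[B, +oo[ (EFin \o (fun t => C * t `^ (- 2^-1 - 1))).
  exact: (integrableZl mB C ip).
apply: (@le_trans _ _ (expR (S ^+ 2 / 2 - x ^+ 2 / 2) / K +
    \int[mu]_(t in `[B, +oo[) (C * t `^ (- 2^-1 - 1)))).
  apply: split_integral_le; rewrite ?expR_ge0//.
  - exact: integrable_spike.
  - move=> t t_gt0 tB; have v0 := slab_var_gt0 tau t t_gt0.
    have /andP[i0 i1] := slab_var_inv_itv tau t t_gt0.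
    apply: ler_wpM2r; first exact: rho_ge0.
    have s1 : (Num.sqrt (1 + t * tau ^+ 2))^-1 <= 1.
      rewrite invf_le1 ?sqrtr_gt0// -[leLHS]sqrtr1 ler_wsqrtr// lerDl.
      by rewrite mulr_ge0 ?sqr_ge0 ?ltW.
    rewrite /gauss_kernel mulrA -[leRHS]mul1r ler_pM ?expR_ge0//.
    + by rewrite mulr_ge0// invr_ge0 sqrtr_ge0.
    + by rewrite mulr_ile1// invr_ge0 sqrtr_ge0.
    rewrite ler_expR xy.
    have uS : t * tau ^+ 2 * y ^+ 2 <= S ^+ 2.
      move: (ltW tB); rewrite /B expr_div_n exprMn ler_pdivlMr ?mulr_gt0 ?exprn_gt0//.
      by rewrite [_ ^+ 2 * _]mulrC mulrA.
    set u := t * tau ^+ 2 in v0 i0 i1 uS *.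
    have -> : - y ^+ 2 / (2 * (1 + u)) = u * y ^+ 2 / 2 * (1 + u)^-1 - y ^+ 2 / 2.
      by field; rewrite gt_eqF.
    rewrite lerD2r (@le_trans _ _ (u * y ^+ 2 / 2))//; last by rewrite ler_wpM2r.
    have u0 : 0 <= u by rewrite mulr_ge0 ?sqr_ge0 ?(ltW t_gt0).
    by rewrite ler_piMr// divr_ge0// mulr_ge0 ?sqr_ge0.
  - move=> t Bt; have t_gt0 : 0 < t by exact: lt_le_trans Bt.
    have v0 := slab_var_gt0 tau t t_gt0.
    rewrite /slab_weight [_ * L t]mulrC mulrA.
    apply: ler_wpM2r; first exact: powR_ge0.
    have -> : C = 3 / y ^+ 3 * M by rewrite /C mulrAC.
    apply: ler_pM; rewrite ?L_le ?(ltW (L_gt0 _ t_gt0))//.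
      have /andP[i0 _] := slab_var_inv_itv tau t t_gt0.
      by rewrite mulr_ge0 ?gauss_kernel_ge0.
    have r0 : 0 < Num.sqrt (1 + t * tau ^+ 2) by rewrite sqrtr_gt0.
    apply: le_trans (cube_expR_le y _ y0 r0).
    rewrite /gauss_kernel sqr_sqrtr ?(ltW v0)// mulrA xy.
    apply: ler_wpM2r; first exact: expR_ge0.
    by rewrite [Num.sqrt _ ^+ 3]exprS sqr_sqrtr ?(ltW v0)// invfM mulrC.
rewrite lerD2l RintegralZl// pE sqrtr_sqr ger0_norm ?(ltW q0)// /C xy.
rewrite le_eqVlt; apply/orP; left; apply/eqP.
by field; rewrite !gt_eqF.
Qed.

(** The constants make the spike part at most a third of the slab part, whence 3/4. Any fixed value
    above 1/2 would survive the averaging over [tau] equally well. *)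
Lemma cond_shrinkage_large : exists B0 x0, [/\ 0 < B0, 0 < x0 &
  forall tau x, 0 < tau <= 1 -> x0 <= `|x| ->
    x ^+ 2 * expR (- (x ^+ 2 / 2)) <= B0 * tau ->
    3 / 4 <= cond_shrinkage 2^-1 L tau x].
Proof.
have M_gt0 : 0 < M by exact: lt_le_trans (L_gt0 1 ltr01) (L_le 1 ltr01).
(* This [S] makes the second term of [spike_part_le] equal to [w / 6], where
   [w] is the lower bound of [slab_part_ge]. *)
pose S := 36 * (32 * M) / c0; have S0 : 0 < S by rewrite divr_gt0 ?mulr_gt0.
(* [B0] makes the first term of [spike_part_le] at most [w / 6] for every admissible x; the two
   terms together are then at most [w / 3]. *)
pose B0 := c0 * K / (6 * (32 * expR (S ^+ 2 / 2))).
have B0_gt0 : 0 < B0 by rewrite divr_gt0 ?mulr_gt0 ?expR_gt0.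
(* This lower bound on |x| ensures both |x| >= 1 and x^2 >= t0, as [slab_part_ge] requires. *)
exists B0, (1 + Num.sqrt t0); split; [by []|by rewrite ltr_wpDr ?sqrtr_ge0|].
move=> tau x tau01 x0x xB; have /andP[tau0 tau1] := tau01.
have y1 : 1 <= `|x| by rewrite (le_trans _ x0x)// lerDl sqrtr_ge0.
have y0 : 0 < `|x| by exact: lt_le_trans y1.
have xt0 : t0 <= x ^+ 2.
  rewrite -(real_normK (num_real x)) -(sqr_sqrtr (ltW t0_gt0)).
  by rewrite ler_pXn2r ?nnegrE ?sqrtr_ge0// (le_trans _ x0x)// lerDr.
have x2 : 0 < x ^+ 2 by exact: lt_le_trans xt0.
have N_ge := slab_part_ge tau x tau01 y1 xt0.
have J_le := spike_part_le tau x S tau0 y0 S0.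
set w := c0 * tau / (32 * x ^+ 2) in N_ge.
have w0 : 0 < w by apply: divr_gt0; apply: mulr_gt0.
have xn0 : x != 0 by rewrite -normr_gt0.
have e1 : expR (S ^+ 2 / 2 - x ^+ 2 / 2) / K <= w / 6.
  rewrite expRD ler_pdivrMr//.
  rewrite -(ler_pM2r x2) -mulrA [_ * x ^+ 2]mulrC.
  apply: le_trans (ler_wpM2l (expR_ge0 _) xB) _.
  rewrite le_eqVlt; apply/orP; left; apply/eqP; rewrite /B0 /w.
  by field; rewrite xn0 !gt_eqF ?expR_gt0.
have e2 : 6 * M * tau / (x ^+ 2 * S) = w / 6.
  by rewrite /S /w; field; rewrite xn0 !gt_eqF.
have JN : spike_part tau x <= slab_part tau x / 3.
  by apply: (le_trans J_le); rewrite e2; lra.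
have N0 : 0 < slab_part tau x by exact: lt_le_trans N_ge.
have J0 := spike_part_ge0 tau x.
rewrite cond_shrinkageE kernel_splitE ler_pdivlMr ?ltr_wpDr//.
by lra.
Qed.

(** * The posterior of the global scale *)

Lemma measurable_kernel_integral (x : R) : measurable_fun setT
  (fun tau : R => \int[mu]_(t in D) (gauss_kernel tau x t * rho t)).
Proof.
(* Tonelli asks for a jointly measurable integrand on the whole plane: [rho] is extended by 0
   outside the half-line and the kernel is written with [powR]. *)
pose f (z : measurableTypeR R * measurableTypeR R) : R :=
  (1 + z.2 * z.1 ^+ 2) `^ (- 2^-1)
    * expR (- x ^+ 2 / 2 * (1 + z.2 * z.1 ^+ 2) `^ (- 1)) * (rho \_ D) z.2.
have mv p : measurable_fun setT
    (fun z : measurableTypeR R * measurableTypeR R => (1 + z.2 * z.1 ^+ 2) `^ p).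
  apply: (@measurableT_comp _ _ _ _ _ _ (@powR R ^~ p)); first exact: measurable_powR.
  apply: measurable_funD => //; apply: measurable_funM => //.
  by apply: measurable_funX.
have mrho : measurable_fun setT (rho \_ D).
  by apply/(measurable_restrictT _ _).1 => //; exact: measurable_rho.
have mf : measurable_fun setT f.
  apply: measurable_funM.
    apply: measurable_funM; first exact: mv.
    by apply: measurableT_comp => //; apply: measurable_funM.
  exact: (measurableT_comp mrho measurable_snd).
have f0 z : 0 <= f z.
  rewrite /f mulr_ge0 ?mulr_ge0 ?powR_ge0 ?expR_ge0//.
  by rewrite patchE; case: ifPn => //; rewrite inE => /itv0yE; exact: rho_ge0.
have mF := @measurable_fun_fubini_tonelli_F _ _ (measurableTypeR R)
  (measurableTypeR R) R mu (EFin \o f) _ _.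
rewrite (_ : (fun tau => _) = fine \o fubini_F mu (EFin \o f)).
  apply: measurableT_comp => //; apply: mF; first exact/measurable_EFinP.
  by move=> z; rewrite lee_fin.
apply/funext => tau; rewrite /= /Rintegral /fubini_F integral_mkcond.
congr fine; apply: eq_integral => t _; rewrite /f /= !patchE.
case: ifPn => [|_]; last by rewrite mulr0.
by rewrite inE => /itv0yE t_gt0; rewrite gauss_kernel_powR// ltW.
Qed.

Lemma marginalE tau x : marginal K 2^-1 L tau x =
  K / Num.sqrt (2 * pi) * \int[mu]_(t in D) (gauss_kernel tau x t * rho t).
Proof.
rewrite -RintegralZl//; last exact: integrable_kernel.
apply: eq_Rintegral => t; rewrite inE => /itv0yE t_gt0.
rewrite sqrtrM; last by rewrite mulr_ge0 ?pi_ge0.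
rewrite invfM /local_prior /gauss_kernel /slab_weight.
move: (Num.sqrt (2 * pi))^-1 (Num.sqrt (1 + _))^-1 (expR _) (powR _ _) => u v e p.
ring.
Qed.


Lemma measurable_marginal (x : R) :
  measurable_fun setT (fun tau => marginal K 2^-1 L tau x).
Proof.
under eq_fun do rewrite marginalE.
by apply: measurable_funM => //; exact: measurable_kernel_integral.
Qed.

Lemma marginal_ge0 tau x : 0 <= marginal K 2^-1 L tau x.
Proof.
rewrite marginalE kernel_splitE mulr_ge0 ?divr_ge0 ?sqrtr_ge0 ?(ltW K_gt0)//.
by rewrite addr_ge0 ?slab_part_ge0 ?spike_part_ge0.
Qed.

Lemma marginal_le tau x : marginal K 2^-1 L tau x <= (Num.sqrt (2 * pi))^-1.
Proof.
rewrite marginalE mulrAC ler_piMl ?invr_ge0 ?sqrtr_ge0// mulrC.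
rewrite -ler_pdivlMr// mul1r -Rintegral_rho; apply: le_Rintegral => //.
- exact: integrable_kernel.
- exact: integrable_rho.
- move=> t /itv0yE t_gt0; apply: ler_piMl; first exact: rho_ge0.
  exact: gauss_kernel_le1.
Qed.

(** Uniformity in [tau] is the point: it keeps the normalizing constant of the posterior away from
    0. *)
Lemma marginal_ge (x : R) : exists2 m, 0 < m &
  forall tau, 0 < tau <= 1 -> m <= marginal K 2^-1 L tau x.
Proof.
have [d0 d0_gt0 d0_le] := kernel_integral_ge.
have k0 : 0 < K / Num.sqrt (2 * pi) by rewrite divr_gt0// sqrtr_gt0 mulr_gt0 ?pi_gt0.
exists (K / Num.sqrt (2 * pi) * (d0 * expR (- x ^+ 2 / 2))).
  by rewrite mulr_gt0// mulr_gt0// expR_gt0.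
by move=> tau tau01; rewrite marginalE ler_pM2l ?d0_le.
Qed.

(** An average against a probability density stays within the bounds of the integrand; the work is
    to show that the normalizer of the posterior is positive and finite. As [lo] is nonnegative, so
    is the integrand, and [ge0_le_integral_nomeas] avoids the measurability of [cond_shrinkage] in
    [tau]. *)
Lemma posterior_mean_bounds (pi2 : R -> R) (n : nat) (x : 'rV[R]_n) (i : 'I_n)
    (alpha lo hi : R) : (0 < n)%N -> alpha <= 1 ->
  prob_density_pos pi2 ->
  (\int[mu]_(tau in `[(n%:R^-1)%R, alpha]) (pi2 tau)%:E = 1)%E ->
  0 <= lo -> (forall tau, n%:R^-1 <= tau <= alpha ->
    lo <= cond_shrinkage 2^-1 L tau (x 0 i) <= hi) ->
  lo <= full_bayes_shrinkage K 2^-1 L pi2 alpha x i <= hi.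
Proof.
move=> n_gt0 alpha1 [mpi pi_ge0 pi_int] pi_supp lo0 lohi.
have n0 : 0 < n%:R^-1 :> R by rewrite invr_gt0 ltr0n.
pose W := posterior_weight K 2^-1 L pi2 x.
pose A : set (measurableTypeR R) := `[n%:R^-1, alpha]%classic.
have mA : measurable A by exact: measurable_itv.
have mD : measurable (D : set (measurableTypeR R)) by [].
have AD : A `<=` D.
  by move=> t; rewrite /A /= !in_itv/= andbT => /andP[+ _]; exact: lt_le_trans.
have mW : measurable_fun D W.
  apply: measurable_funM => //; apply: measurable_prod => j _.
  by apply: measurable_funTS; apply: measurable_marginal.
pose C := (Num.sqrt (2 * pi))^-1 ^+ n : R.
have C0 : 0 <= C by rewrite exprn_ge0 ?invr_ge0 ?sqrtr_ge0.
have p0 tau : 0 <= \prod_(j < n) marginal K 2^-1 L tau (x 0 j).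
  by apply: prodr_ge0 => j _; exact: marginal_ge0.
have W0 tau : 0 < tau -> 0 <= W tau.
  by move=> /pi_ge0 h; exact: mulr_ge0.
have W_le tau : 0 < tau -> W tau <= C * pi2 tau.
  move=> /pi_ge0 h; rewrite /W /posterior_weight mulrC ler_wpM2r//.
  rewrite /C -[X in _ ^+ X]card_ord -prodr_const; apply: ler_prod => j _.
  by rewrite marginal_ge0 marginal_le.
have [m m0 W_ge] : exists2 m, 0 < m & forall tau, A tau -> m * pi2 tau <= W tau.
  pose mj j := sval (cid2 (marginal_ge (x 0 j))).
  have mj0 j : 0 < mj j by rewrite /mj; case: cid2.
  exists (\prod_(j < n) mj j); first by apply: prodr_gt0.
  move=> tau Atau; have /itv0yE tau0 := AD _ Atau.
  rewrite /W /posterior_weight mulrC ler_wpM2l ?pi_ge0//; apply: ler_prod => j _.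
  rewrite ltW//= /mj; case: cid2 => /= r r0; apply.
  by move: Atau; rewrite /A /= in_itv/= tau0 => /andP[_ /le_trans]; exact.
have mpiE B : measurable B -> B `<=` D -> measurable_fun B (fun t => (pi2 t)%:E).
  by move=> mB BD; apply/measurable_EFinP; exact: measurable_funS mpi.
have mWE B : measurable B -> B `<=` D -> measurable_fun B (fun t => (W t)%:E).
  by move=> mB BD; apply/measurable_EFinP; exact: measurable_funS mW.
have DE : D = A `|` (D `\` A) by rewrite setDUK.
have mDA : measurable (D `\` A) by exact: measurableD.
have DAD : D `\` A `<=` D by exact: subDsetl.
have disj : [disjoint A & D `\` A] by apply/disj_setPS => t [? []].
have pi0 B : B `<=` D -> forall t, B t -> (0 <= (pi2 t)%:E)%E.
  by move=> BD t /BD/itv0yE/pi_ge0; rewrite lee_fin.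
have W0E B : B `<=` D -> forall t, B t -> (0 <= (W t)%:E)%E.
  by move=> BD t /BD/itv0yE/W0; rewrite lee_fin.
(* [pi2] has mass 1 both on the half-line and on [A], so the normalizer, an integral over the
   half-line, reduces to one over [A]. *)
have piDA : (\int[mu]_(t in D `\` A) (pi2 t)%:E = 0)%E.
  have := pi_int; rewrite {1}DE ge0_integral_setU//; last 2 first.
  - by rewrite -DE; exact: mpiE.
  - by rewrite -DE; exact: pi0.
  rewrite pi_supp => /(congr1 (fun z => z - 1)%E).
  by rewrite addeAC subee// add0e.
have WDA : (\int[mu]_(t in D `\` A) (W t)%:E = 0)%E.
  apply/eqP; rewrite eq_le; apply/andP; split; last exact/integral_ge0/W0E.
  apply: (@le_trans _ _ (\int[mu]_(t in D `\` A) (C%:E * (pi2 t)%:E))%E).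
    apply: ge0_le_integral => //.
    - exact: W0E.
    - exact: mWE.
    - by apply: emeasurable_funM => //; exact: mpiE.
    - by move=> t /DAD/itv0yE/W_le; rewrite lee_fin.
  by rewrite ge0_integralZl_EFin// ?piDA ?mule0//; [exact: pi0|exact: mpiE].
have WE : (\int[mu]_(t in D) (W t)%:E = \int[mu]_(t in A) (W t)%:E)%E.
  rewrite {1}DE ge0_integral_setU//; last 2 first.
  - by rewrite -DE; exact: mWE.
  - by rewrite -DE; exact: W0E.
  by rewrite WDA adde0.
have W_fin : (\int[mu]_(t in A) (W t)%:E <= C%:E)%E.
  apply: (@le_trans _ _ (\int[mu]_(t in A) (C%:E * (pi2 t)%:E))%E).
    apply: ge0_le_integral => //.
    - exact: W0E.
    - exact: mWE.
    - by apply: emeasurable_funM => //; exact: mpiE.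
    - by move=> t /AD/itv0yE/W_le; rewrite lee_fin.
  rewrite ge0_integralZl_EFin// ?pi_supp ?mule1//; [exact: pi0|exact: mpiE].
have W_pos : (m%:E <= \int[mu]_(t in A) (W t)%:E)%E.
  apply: (@le_trans _ _ (\int[mu]_(t in A) (m%:E * (pi2 t)%:E))%E).
    rewrite ge0_integralZl_EFin// ?pi_supp ?mule1// ?ltW//.
    - exact: pi0.
    - exact: mpiE.
  apply: ge0_le_integral => //.
  - by move=> t /AD/itv0yE/pi_ge0 h; rewrite lee_fin mulr_ge0// ltW.
  - by apply: emeasurable_funM => //; exact: mpiE.
  - exact: mWE.
pose Z := \int[mu]_(s in D) W s.
have ZE : (Z%:E = \int[mu]_(t in A) (W t)%:E)%E.
  rewrite /Z /Rintegral fineK WE// ge0_fin_numE.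
    by rewrite (le_lt_trans W_fin) ?ltry.
  by rewrite (le_trans _ W_pos)// lee_fin ltW.
have Z0 : 0 < Z by rewrite -lte_fin ZE (lt_le_trans _ W_pos)// lte_fin.
have post1 : (\int[mu]_(t in A) (W t / Z)%:E = 1)%E.
  under eq_integral do rewrite mulrC EFinM.
  rewrite ge0_integralZl_EFin//.
  - by rewrite -ZE -EFinM mulVf ?gt_eqF.
  - exact: W0E.
  - exact: mWE.
  - by rewrite invr_ge0 ltW.
have mpost : measurable_fun A (fun t => (W t / Z)%:E).
  by apply/measurable_EFinP; apply: measurable_funM => //; exact: measurable_funS mW.
have post0 t : A t -> 0 <= W t / Z.
  by move=> /AD/itv0yE/W0 h; rewrite divr_ge0// ltW.
have lohiA t : A t -> lo <= cond_shrinkage 2^-1 L t (x 0 i) <= hi.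
  by rewrite /A /= in_itv/=; exact: lohi.
have up : (\int[mu]_(t in A) (cond_shrinkage 2^-1 L t (x 0 i) * (W t / Z))%:E
    <= hi%:E)%E.
  (* A negative [hi] would force [A] to be empty, against [post1]. *)
  have hi0 : 0 <= hi.
    apply: contrapT => /negP; rewrite -ltNge => hi0.
    have : A = set0.
      apply/eqP/negPn/negP => /set0P[t /lohiA /andP[h1 h2]].
      by move: (le_lt_trans (le_trans h1 h2) hi0); rewrite ltNge lo0.
    move=> A0; move: post1; rewrite A0 integral_set0 => /esym/eqP.
    by rewrite onee_eq0.
  rewrite -[leRHS]mule1 -post1 -ge0_integralZl_EFin//.
  apply: ge0_le_integral_nomeas => t At; have /andP[h1 h2] := lohiA t At.
    by rewrite lee_fin mulr_ge0 ?post0// (le_trans lo0).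
  by rewrite lee_fin ler_wpM2r ?post0.
have down : (lo%:E <=
    \int[mu]_(t in A) (cond_shrinkage 2^-1 L t (x 0 i) * (W t / Z))%:E)%E.
  rewrite -[leLHS]mule1 -post1 -ge0_integralZl_EFin//.
  apply: ge0_le_integral_nomeas => t At; have /andP[h1 h2] := lohiA t At.
    by rewrite lee_fin mulr_ge0 ?post0.
  by rewrite lee_fin ler_wpM2r ?post0.
have fin : (\int[mu]_(t in A) (cond_shrinkage 2^-1 L t (x 0 i) * (W t / Z))%:E
    \is a fin_num)%E.
  rewrite ge0_fin_numE; first by rewrite (le_lt_trans up) ?ltry.
  by rewrite (le_trans _ down)// lee_fin.
have -> : full_bayes_shrinkage K 2^-1 L pi2 alpha x i =
  fine (\int[mu]_(t in A) (cond_shrinkage 2^-1 L t (x 0 i) * (W t / Z))%:E)%E by [].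
by rewrite -!lee_fin fineK// down up.
Qed.

(** By contraposition: if |x_i| <= u, the conditional shrinkage is at most 1/2 for every [tau] in
    the range, hence so is its average, whatever posterior weights the other coordinates induce. *)
Lemma full_bayes_rule_gt (pi2 : R -> R) (n : nat) (alpha u A0 : R)
    (x : 'rV[R]_n) (i : 'I_n) : alpha <= 1 ->
  prob_density_pos pi2 ->
  (\int[mu]_(tau in `[(n%:R^-1)%R, alpha]) (pi2 tau)%:E = 1)%E ->
  0 <= A0 ->
  (forall tau y, 0 < tau <= 1 ->
    cond_shrinkage 2^-1 L tau y <= A0 * tau * expR (y ^+ 2 / 2)) ->
  A0 * alpha * expR (u ^+ 2 / 2) <= 2^-1 ->
  full_bayes_rule K 2^-1 L pi2 alpha x i -> u < `|x 0 i|.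
Proof.
move=> alpha1 pi_d pi_s A00 condA uA rule; rewrite ltNge; apply/negP => xu.
have n_gt0 : (0 < n)%N by exact: leq_ltn_trans (ltn_ord i).
suff /andP[_ h] : 0 <= full_bayes_shrinkage K 2^-1 L pi2 alpha x i <= 2^-1.
  by move: rule; rewrite /full_bayes_rule ltNge h.
apply: posterior_mean_bounds => // tau /andP[tau_n tau_a].
have tau0 : 0 < tau by rewrite (lt_le_trans _ tau_n)// invr_gt0 ltr0n.
rewrite cond_shrinkage_ge0/= (le_trans (condA _ _ _)) ?tau0 ?(le_trans tau_a)//.
apply: le_trans uA; apply: ler_pM; rewrite ?expR_ge0//.
- by rewrite mulr_ge0// ltW.
- by rewrite ler_wpM2l.
rewrite ler_expR ler_pM2r// -(real_normK (num_real (x 0 i))).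
by rewrite ler_pXn2r ?nnegrE// (le_trans _ xu).
Qed.

Lemma full_bayes_rule_true (pi2 : R -> R) (n : nat) (alpha v : R)
    (x : 'rV[R]_n) (i : 'I_n) : alpha <= 1 ->
  prob_density_pos pi2 ->
  (\int[mu]_(tau in `[(n%:R^-1)%R, alpha]) (pi2 tau)%:E = 1)%E ->
  (forall tau y, n%:R^-1 <= tau <= alpha -> v <= `|y| ->
    3 / 4 <= cond_shrinkage 2^-1 L tau y) ->
  v <= `|x 0 i| -> full_bayes_rule K 2^-1 L pi2 alpha x i.
Proof.
move=> alpha1 pi_d pi_s condv xv.
have n_gt0 : (0 < n)%N by exact: leq_ltn_trans (ltn_ord i).
suff /andP[h _] : 3 / 4 <= full_bayes_shrinkage K 2^-1 L pi2 alpha x i <= 1.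
  by rewrite /full_bayes_rule (lt_le_trans _ h)//; lra.
apply: posterior_mean_bounds => // tau tau_na.
by rewrite condv//= cond_shrinkage_le1.
Qed.

End polynomial_prior.

(** * The standard normal distribution *)

Section std_normal.
Context {R : realType}.
Local Notation mu := (@lebesgue_measure R).
Local Notation N := (@normal_prob R 0 1).
Local Notation pdf := (@normal_pdf R 0 1).

Lemma std_normal_pdfE (x : R) :
  pdf x = (Num.sqrt (2 * pi))^-1 * expR (- (x ^+ 2 / 2)).
Proof.
rewrite normal_pdfE ?oner_eq0// /normal_peak /normal_fun expr1n mul1r subr0 mulNr.
by rewrite mulr_natl.
Qed.

Lemma sqrt2pi_ge1 : 1 <= Num.sqrt (2 * pi) :> R.
Proof.
rewrite -[leLHS]sqrtr1 ler_wsqrtr//; have := @pi_ge2 R; lra.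
Qed.

Lemma std_normal_pdf_le (x : R) : pdf x <= expR (- (x ^+ 2 / 2)).
Proof.
rewrite std_normal_pdfE ler_piMl ?expR_ge0// invf_le1 ?sqrt2pi_ge1//.
by rewrite (lt_le_trans ltr01) ?sqrt2pi_ge1.
Qed.

Lemma std_normal_pdf_le1 (x : R) : pdf x <= 1.
Proof.
rewrite (le_trans (std_normal_pdf_le x))// expR_le1 oppr_le0 divr_ge0//.
exact: sqr_ge0.
Qed.

Lemma measurable_std_normal_pdf (A : set R) : measurable_fun A (fun x => (pdf x)%:E).
Proof. by apply/measurable_EFinP; apply: measurable_funTS; exact: measurable_normal_pdf. Qed.

Lemma normal_prob_fin (A : set R) : measurable A -> N A \is a fin_num.
Proof. by move=> mA; exact: fin_num_measure. Qed.

Lemma PhiE (x : R) : (Phi x)%:E = N `]-oo, x].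
Proof. by rewrite /Phi fineK// normal_prob_fin. Qed.

Lemma normal_prob_itvoc (a b : R) : a <= b ->
  N `]a, b] = (Phi b - Phi a)%:E.
Proof.
move=> ab; rewrite EFinB !PhiE.
have -> : `]-oo, b]%classic = `]-oo, a] `|` `]a, b] :> set R.
  by rewrite -itv_bndbnd_setU// bnd_simp.
rewrite measureU//.
  by rewrite addeAC subee ?add0e// normal_prob_fin.
apply/seteqP; split => // x [] /=; rewrite !in_itv/= => xa /andP[ax _].
by have := lt_le_trans ax xa; rewrite ltxx.
Qed.

Lemma Phi_le (a b : R) : a <= b -> Phi a <= Phi b.
Proof.
by move=> ab; rewrite -subr_ge0 -lee_fin -normal_prob_itvoc// measure_ge0.
Qed.

(** The density is at most 1. This turns small shifts of the thresholds into small errors in the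
    risk. *)
Lemma Phi_lipschitz (a b : R) : a <= b -> Phi b - Phi a <= b - a.
Proof.
move=> ab; rewrite -lee_fin -normal_prob_itvoc//.
have -> : ((b - a)%:E = \int[mu]_(x in `]a, b]) 1%:E)%E.
  rewrite integral_cst// mul1e.
  have := @lebesgue_measure_itv R `]a, b]; rewrite /= lte_fin => ->.
  by case: ltgtP ab => //= -> _; rewrite subrr.
apply: ge0_le_integral_nomeas => x _; rewrite lee_fin ?normal_pdf_ge0//.
exact: std_normal_pdf_le1.
Qed.

Lemma Phi_ge0 (x : R) : 0 <= Phi x.
Proof. by rewrite -lee_fin PhiE measure_ge0. Qed.

Lemma normal_prob_upper (x : R) : N `[x, +oo[ = (Phi (- x))%:E.
Proof.
rewrite PhiE /normal_prob ge0_integration_by_substitutionNy.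
- apply: eq_integral => y _ /=; congr EFin.
  by rewrite !std_normal_pdfE sqrrN.
- apply: continuous_subspaceT; apply: continuous_normal_pdf; exact: oner_neq0.
- by move=> y _; exact: normal_pdf_ge0.
Qed.

Lemma Phi_sym (x : R) : Phi (- x) = 1 - Phi x.
Proof.
apply: EFin_inj; rewrite -normal_prob_upper EFinB PhiE.
have <- : N setT = 1%:E by exact: probability_setT.
have -> : [set: R] = `]-oo, x] `|` `]x, +oo[.
  by rewrite -itv_bndbnd_setU// ?bnd_simp// set_itvNyy.
rewrite measureU//; last first.
  apply/seteqP; split => // y [] /=; rewrite !in_itv/= andbT => yx xy.
  by have := lt_le_trans xy yx; rewrite ltxx.
rewrite addeAC subee ?normal_prob_fin// add0e.
(* The law has a density, so the end point of the half-line carries no mass. *)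
transitivity (\int[mu]_(y in `]x, +oo[) (pdf y)%:E)%E; last by [].
by rewrite integral_itv_obnd_cbnd//; exact: measurable_std_normal_pdf.
Qed.

(** On [u, +oo[ the factor t/u is at least 1, so the density is at most (t/u) exp(-t^2/2), which has
    an explicit antiderivative. *)
Lemma Phi_mills (u : R) : 0 < u -> Phi (- u) <= expR (- (u ^+ 2 / 2)) / u.
Proof.
move=> u0; rewrite -lee_fin -normal_prob_upper.
have [x ux|x ux|x ux||iT iE] := @ge0_FTC_tail R
    (fun t => t / u * expR (- (t ^+ 2 / 2)))
    (fun t => - u^-1 * expR (- (t ^+ 2 / 2))) u 0.
- by rewrite mulr_ge0 ?expR_ge0// divr_ge0 ?(ltW u0)// (le_trans (ltW u0)).
- apply: cvgM; first by apply: cvgMl.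
  apply: continuous_comp; last exact: continuous_expR.
  by apply: cvgN; apply: cvgMl; exact: sqr_continuous.
- pose g (t : R) : R := - (t ^+ 2 / 2).
  have gE : g = - (2^-1 \*: (id ^+ 2)).
    by apply/funext => t; rewrite /g mulrC.
  have dg : is_derive x 1 g (- x).
    rewrite gE; apply: is_derive_eq; rewrite /GRing.scale/= expr1.
    by field.
  have de := is_derive1_comp (is_derive_expR (g x)) dg.
  apply: (is_derive_eq (is_deriveZ (- u^-1) de)).
  rewrite /g /GRing.scale/=.
  by field; rewrite gt_eqF.
- apply/cvgrPdist_le => e e0; near=> t.
  have t1 : 1 <= t by near: t; exact/nbhs_pinfty_ge/num_real.
  have te : 2 / (u * e) <= t by near: t; exact/nbhs_pinfty_ge/num_real.
  have t0 : 0 < t by rewrite (lt_le_trans ltr01).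
  rewrite sub0r normrN mulNr normrN ger0_norm; last first.
    by rewrite mulr_ge0 ?expR_ge0// invr_ge0 ltW.
  rewrite ler_pdivrMl// expRN -[leRHS]invrK lef_pV2 ?posrE ?expR_gt0 ?invr_gt0 ?mulr_gt0//.
  apply: le_trans (expR_ge1Dx _); apply: (@le_trans _ _ (t ^+ 2 / 2)); last first.
    by rewrite lerDr.
  rewrite ler_pdivlMr// mulrC (le_trans te)// expr2 ler_peMr// ltW.
have fE : 0 - - u^-1 * expR (- (u ^+ 2 / 2)) = expR (- (u ^+ 2 / 2)) / u.
  by rewrite sub0r mulNr opprK mulrC.
rewrite -fE -iE -[leRHS]/((fine _)%:E) fineK; last first.
  exact: integrable_fin_num.
apply: ge0_le_integral_nomeas => t; rewrite /= in_itv/= andbT => ut.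
  by rewrite lee_fin normal_pdf_ge0.
rewrite lee_fin (le_trans (std_normal_pdf_le t))// ler_peMl ?expR_ge0//.
by rewrite ler_pdivlMr// mul1r.
Unshelve. all: by end_near. Qed.

Lemma Phi_cvg1 : Phi x @[x --> +oo] --> (1 : R).
Proof.
apply/cvgrPdist_le => e e0; near=> t.
have te : e^-1 <= t by near: t; exact/nbhs_pinfty_ge/num_real.
have t0 : 0 < t by rewrite (lt_le_trans _ te)// invr_gt0.
rewrite -Phi_sym ger0_norm ?Phi_ge0// (le_trans (Phi_mills _ t0))//.
rewrite (@le_trans _ _ t^-1)//.
  by rewrite ler_piMl ?invr_ge0 ?(ltW t0)// expR_le1 oppr_le0 divr_ge0 ?sqr_ge0.
by rewrite -[leRHS]invrK lef_pV2 ?posrE ?invr_gt0.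
Unshelve. all: by end_near. Qed.

End std_normal.

(** * Risk of rules sandwiched between two thresholds *)

Lemma expectation_integral {R : realType} {d} {T : measurableType d}
    (P : probability T R) (f : T -> R) : ('E_P[f] = \int[P]_w (f w)%:E)%E.
Proof. by rewrite unlock. Qed.

Section gaussian_noise.
Context {R : realType} {d : measure_display} {T : measurableType d}.
Context (P : probability T R) (I : finType) (X : I -> {RV P >-> R}).
Hypothesis X_normal : forall i (A : set R), measurable A ->
  distribution P (X i) A = normal_prob 0 1 A.
Local Notation N := (@normal_prob R 0 1).

Lemma integral_sum_indic (Q : pred I) (A : I -> set R) (c : R) :
  (forall i, measurable (A i)) -> 0 <= c ->
  (\int[P]_w (c * \sum_(i | Q i) \1_(A i) (X i w))%:E =
   (c * \sum_(i | Q i) fine (N (A i)))%:E)%E.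
Proof.
move=> mA c0.
have mX i : measurable (X i @^-1` A i).
  by rewrite -[Y in measurable Y]setTI; exact: measurable_funP.
have mI i : measurable_fun setT (fun w => (\1_(A i) (X i w))%:E : \bar R).
  apply/measurable_EFinP.
  rewrite (_ : (fun w => _) = \1_(X i @^-1` A i)); last first.
    by apply/funext => w; rewrite !indicE; congr ((_ : bool)%:R); apply/idP/idP; rewrite !inE.
  exact: measurable_indic.
under eq_integral do rewrite EFinM -sumEFin -big_filter.
rewrite ge0_integralZl_EFin//; last 2 first.
- by move=> w _; rewrite sume_ge0// => i _; rewrite lee_fin.
- exact: emeasurable_sum.
rewrite ge0_integral_sum//.
rewrite EFinM -sumEFin -[in RHS]big_filter; congr (_ * _)%E; apply: eq_bigr => i _.
rewrite (eq_integral (fun w => (\1_(X i @^-1` A i) w)%:E)); last first.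
  move=> w _; rewrite !indicE; congr ((_ : bool)%:R)%:E; apply/idP/idP; rewrite !inE//.
rewrite integral_indic// setIT fineK ?normal_prob_fin//.
by rewrite -(X_normal i).
Qed.

Lemma expectation_le_indic (Q : pred I) (A : I -> set R) (c : R) (f : T -> R) :
  (forall i, measurable (A i)) -> 0 <= c ->
  (forall w, 0 <= f w) ->
  (forall w, f w <= c * \sum_(i | Q i) \1_(A i) (X i w)) ->
  ('E_P[f] <= (c * \sum_(i | Q i) fine (N (A i)))%:E)%E.
Proof.
move=> mA c0 f0 fA; rewrite expectation_integral -integral_sum_indic//.
by apply: ge0_le_integral_nomeas => w _; rewrite lee_fin.
Qed.

Lemma expectation_ge_indic (Q : pred I) (A : I -> set R) (c : R) (f : T -> R) :
  (forall i, measurable (A i)) -> 0 <= c ->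
  (forall w, c * \sum_(i | Q i) \1_(A i) (X i w) <= f w) ->
  ((c * \sum_(i | Q i) fine (N (A i)))%:E <= 'E_P[f])%E.
Proof.
move=> mA c0 fA; rewrite expectation_integral -integral_sum_indic//.
apply: ge0_le_integral_nomeas => w _; rewrite lee_fin//.
by rewrite mulr_ge0// sumr_ge0.
Qed.

End gaussian_noise.

Section threshold_rule_risk.
Context {R : realType} {d : measure_display} {T : measurableType d}.
Context (P : probability T R) (n : nat) (eps : 'I_n -> {RV P >-> R}).
Hypothesis eps_normal : forall i (A : set R), measurable A ->
  distribution P (eps i) A = normal_prob 0 1 A.
Context (psi : 'rV[R]_n -> 'I_n -> bool).
Local Notation N := (@normal_prob R 0 1).

Lemma FDR_ge0 theta : (0 <= FDR eps psi theta)%E.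
Proof.
rewrite /FDR expectation_integral; apply: integral_ge0 => w _; rewrite lee_fin divr_ge0//.
  by apply: sumr_ge0.
by rewrite le_max ler01 orbT.
Qed.

Lemma FNR_ge0 theta : (0 <= FNR eps psi theta)%E.
Proof.
rewrite /FNR expectation_integral; apply: integral_ge0 => w _; rewrite lee_fin divr_ge0//.
by apply: sumr_ge0 => i _; rewrite subr_ge0; case: psi.
Qed.

Lemma risk_ge0 theta : (0 <= risk eps psi theta)%E.
Proof. by rewrite adde_ge0 ?FDR_ge0 ?FNR_ge0. Qed.

(** The denominator is at least 1, so the proportion is at most the number of null coordinates whose
    noise reaches [u] in absolute value; each contributes two Gaussian tails. *)
Lemma FDR_le (u : R) (theta : 'rV[R]_n) : 0 < u ->
  (forall x i, psi x i -> u <= `|x 0 i|) ->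
  (FDR eps psi theta <= (2 * n%:R * (expR (- (u ^+ 2 / 2)) / u))%:E)%E.
Proof.
move=> u0 psi_u.
pose A (i : 'I_n) : set R := `]-oo, (- u)] `|` `[u, +oo[.
have mA i : measurable (A i) by exact: measurableU.
have NA i : fine (N (A i)) <= 2 * (expR (- (u ^+ 2 / 2)) / u).
  rewrite -lee_fin fineK ?normal_prob_fin//.
  apply: (le_trans (measureU2 _ _ _)) => //.
  apply: (@le_trans _ _ ((Phi (- u))%:E + (Phi (- u))%:E)%E).
    by apply: leeD; [rewrite PhiE|rewrite -normal_prob_upper]; exact: lexx.
  by rewrite -EFinD lee_fin mulr_natl lerD// Phi_mills.
apply: le_trans (expectation_le_indic _ _ eps eps_normal
   (fun i => theta 0 i == 0) A 1 _ mA _ _ _) _ => //.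
- move=> w; rewrite divr_ge0//; first exact: sumr_ge0.
  by rewrite le_max ler01 orbT.
- move=> w; rewrite mul1r.
  apply: (@le_trans _ _
      (\sum_(i < n | theta 0 i == 0) (psi (observation eps theta w) i)%:R)).
    rewrite ler_pdivrMr; last by rewrite lt_max ltr01 orbT.
    by rewrite ler_peMr ?sumr_ge0// le_max lexx orbT.
  apply: ler_sum => i /eqP ti0; case: (boolP (psi _ _)) => [/psi_u|_ //].
  rewrite mxE ti0 add0r => ux; rewrite indicE mem_set//.
  rewrite /A /= !in_itv/= andbT.
  by move: ux; rewrite ler_normr => /orP[|]; [right|left; rewrite lerNr].
- rewrite mul1r lee_fin.
  apply: (@le_trans _ _ (\sum_(i < n) 2 * (expR (- (u ^+ 2 / 2)) / u))).
    rewrite [leRHS](bigID (fun i => theta 0 i == 0))/=.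
    rewrite -[leLHS]addr0 lerD//; first exact: ler_sum.
    by apply: sumr_ge0 => i _; rewrite mulr_ge0// divr_ge0 ?expR_ge0 ?(ltW u0).
  rewrite sumr_const card_ord -(mulr_natr _ n).
  by rewrite le_eqVlt; apply/orP; left; apply/eqP; ring.
Qed.

(** A missed signal has |theta_i + eps_i| < v. Only the inequality on the side of the sign of
    theta_i is kept; it puts the noise in a half-line of probability at most [Phi (v - m)]. *)
Lemma FNR_le (v m : R) (theta : 'rV[R]_n) : (0 < #|supp theta|)%N ->
  (forall (x : 'rV[R]_n) i, v <= `|x 0 i| -> psi x i) ->
  (forall i, i \in supp theta -> m <= `|theta 0 i|) ->
  (FNR eps psi theta <= (Phi (v - m))%:E)%E.
Proof.
move=> q0 psi_v theta_m.
pose A (i : 'I_n) : set R :=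
  if 0 < theta 0 i then `]-oo, (v - theta 0 i)]%classic
  else `[(- v - theta 0 i), +oo[%classic.
have mA i : measurable (A i) by rewrite /A; case: ifP.
have NA i : theta 0 i != 0 -> fine (N (A i)) <= Phi (v - m).
  move=> ti; have tm := theta_m i; rewrite inE ti in tm.
  have {}tm := tm isT.
  rewrite -lee_fin fineK ?normal_prob_fin// /A.
  case: ltP => [t0|t0].
    rewrite -PhiE lee_fin Phi_le// lerD2l lerN2.
    by move: tm; rewrite gtr0_norm.
  rewrite normal_prob_upper lee_fin Phi_le// opprD opprK opprK lerD2l.
  by rewrite lerNr; move: tm; rewrite ler0_norm.
have qr0 : 0 < #|supp theta|%:R :> R by rewrite ltr0n.
have qmax : Num.max #|supp theta|%:R 1 = #|supp theta|%:R :> R.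
  by apply/max_idPl; rewrite ler1n.
rewrite /FNR qmax.
apply: le_trans (expectation_le_indic _ _ eps eps_normal
   (fun i => theta 0 i != 0) A (#|supp theta|%:R)^-1 _ mA _ _ _) _ => //.
- move=> w; rewrite divr_ge0 ?(ltW qr0)//.
  by apply: sumr_ge0 => i _; rewrite subr_ge0; case: psi.
- move=> w; rewrite mulrC ler_pM2l ?invr_gt0//; apply: ler_sum => i ti0.
  case: (boolP (psi _ _)) => [_|npsi]; first by rewrite subrr.
  have : `|theta 0 i + eps i w| < v.
    rewrite ltNge; apply/negP => h; move/negP : npsi; apply.
    by apply: psi_v; rewrite mxE.
  rewrite ltr_norml subr0 => /andP[h1 h2]; rewrite indicE mem_set// /A.
  case: ltP => _ /=; rewrite in_itv/= ?andbT.
    by rewrite lerBrDl ltW.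
  by rewrite lerBlDl ltW.
- rewrite lee_fin mulrC ler_pdivrMr//.
  apply: (@le_trans _ _ (\sum_(i < n | theta 0 i != 0) Phi (v - m))).
    exact: ler_sum.
  rewrite sumr_const le_eqVlt; apply/orP; left; apply/eqP.
  rewrite -[LHS]mulr_natr.
  by congr (_ * _%:R); apply: eq_card => i; rewrite !inE.
Qed.

(** Noise in ]-u - m, u - m] keeps the observation within [-u, u], where nothing is rejected; the
    right end may be included because rejection requires a strict inequality. Equal signals make the
    average over the support a single probability. *)
Lemma FNR_ge (u m : R) (theta : 'rV[R]_n) : (0 < #|supp theta|)%N -> 0 <= u ->
  (forall x i, psi x i -> u < `|x 0 i|) ->
  (forall i, i \in supp theta -> theta 0 i = m) ->
  ((Phi (u - m) - Phi (- u - m))%:E <= FNR eps psi theta)%E.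
Proof.
move=> q0 u0 psi_u theta_m.
pose A (i : 'I_n) : set R := `](- u - m), (u - m)]%classic.
have mA i : measurable (A i) by exact: measurable_itv.
have NA i : fine (N (A i)) = Phi (u - m) - Phi (- u - m).
  by rewrite normal_prob_itvoc// lerD2r (le_trans _ u0)// oppr_le0.
have qr0 : 0 < #|supp theta|%:R :> R by rewrite ltr0n.
have qmax : Num.max #|supp theta|%:R 1 = #|supp theta|%:R :> R.
  by apply/max_idPl; rewrite ler1n.
rewrite /FNR qmax.
apply: le_trans (expectation_ge_indic _ _ eps eps_normal
   (fun i => theta 0 i != 0) A (#|supp theta|%:R)^-1 _ mA _ _) => //.
- under eq_bigr do rewrite NA.
  rewrite sumr_const lee_fin -[X in _ * X]mulr_natr mulrCA.
  rewrite (_ : #|_| = #|supp theta|); last by apply: eq_card => i; rewrite !inE.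
  by rewrite mulVf ?mulr1// gt_eqF.
- move=> w; rewrite mulrC ler_pM2r ?invr_gt0//; apply: ler_sum => i ti0.
  rewrite indicE; case: (boolP (_ \in _)) => [|_]; last by rewrite subr_ge0; case: psi.
  rewrite inE /A /= in_itv/= => /andP[h1 h2].
  case: (boolP (psi _ _)) => [/psi_u|_]; last by rewrite subr0.
  rewrite mxE theta_m ?inE// ltNge ler_norml => /negP[].
  by rewrite -lerBlDl ltW//= -lerBrDl.
Qed.

Lemma sup_risk_le (q : nat) (b u v : R) : (0 < q)%N -> 0 < u ->
  (forall x i, psi x i -> u <= `|x 0 i|) ->
  (forall (x : 'rV[R]_n) i, v <= `|x 0 i| -> psi x i) ->
  (sup_risk eps psi q b <= (2 * n%:R * (expR (- (u ^+ 2 / 2)) / u) +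
     Phi (v - (Num.sqrt (2 * ln (n%:R / q%:R)) + b)))%:E)%E.
Proof.
move=> q0 u0 psi_u psi_v; apply: ge_ereal_sup => _ [theta [cardq theta_ge] <-].
rewrite EFinD leeD ?FDR_le//.
by apply: FNR_le => //; rewrite cardq.
Qed.

(** Witness for lower bounds on the supremum: with [m] equal to the beta-min threshold, its signals
    are as weak as the class allows. *)
Definition spike_mean (q : nat) (m : R) : 'rV[R]_n :=
  \row_(i < n) if ((i : nat) < q)%N then m else 0.

Lemma supp_spike_mean (q : nat) (m : R) : (q <= n)%N -> m != 0 ->
  supp (spike_mean q m) = [set i : 'I_n | (i < q)%N]%SET /\ #|supp (spike_mean q m)| = q.
Proof.
move=> qn m0; have sE : supp (spike_mean q m) = [set i : 'I_n | (i < q)%N]%SET.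
  by apply/setP => i; rewrite !inE mxE; case: ifP; rewrite ?eqxx.
split => //; rewrite sE -[RHS]card_ord.
have wi : injective (widen_ord qn) by move=> j k /(congr1 val)/= /val_inj.
rewrite -(card_imset _ wi); apply: eq_card => i; rewrite !inE.
apply/idP/imsetP => [iq|[j _ ->]]; last by rewrite /=.
by exists (Ordinal iq) => //; apply/val_inj.
Qed.

(** The supremum over an empty class would be [-oo], so a member has to be exhibited. The chosen [m]
    is positive and exceeds the threshold whatever the sign of the latter. *)
Lemma sup_risk_ge0 (q : nat) (b : R) : (q <= n)%N ->
  (0 <= sup_risk eps psi q b)%E.
Proof.
move=> qn; pose m := `|Num.sqrt (2 * ln (n%:R / q%:R)) + b| + 1 : R.
have m0 : 0 < m by rewrite ltr_wpDl.
have [sE cE] := supp_spike_mean q m qn (lt0r_neq0 m0).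
apply: (le_trans (risk_ge0 (spike_mean q m))); apply: ereal_sup_ubound.
exists (spike_mean q m) => //; split => // i; rewrite sE inE mxE => ->.
by rewrite (gtr0_norm m0) (le_trans (ler_norm _))// lerDl.
Qed.

Lemma sup_risk_ge (q : nat) (b u : R) : (0 < q <= n)%N -> 0 <= u ->
  let m := Num.sqrt (2 * ln (n%:R / q%:R)) + b in 0 < m ->
  (forall x i, psi x i -> u < `|x 0 i|) ->
  ((Phi (u - m) - Phi (- u - m))%:E <= sup_risk eps psi q b)%E.
Proof.
move=> /andP[q0 qn] u0 m m0 psi_u.
have [sE cE] := supp_spike_mean q m qn (lt0r_neq0 m0).
apply: (@le_trans _ _ (risk eps psi (spike_mean q m))).
  apply: (@le_trans _ _ (FNR eps psi (spike_mean q m))); last first.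
    by rewrite leeDr ?FDR_ge0.
  apply: FNR_ge => //; first by rewrite cE.
  by move=> i; rewrite sE inE mxE => ->.
apply: ereal_sup_ubound; exists (spike_mean q m) => //; split => // i.
by rewrite sE inE mxE => ->; rewrite (gtr0_norm m0).
Qed.

End threshold_rule_risk.

(** * Asymptotics of the thresholds *)

Section growth.
Context {R : realType}.
Implicit Types (e l s x : R).

Lemma cvg_ln_nat : ln (n%:R : R) @[n --> \oo] --> +oo.
Proof.
apply/cvgryPge => A; near=> n.
rewrite -[A]expRK ler_ln ?posrE ?expR_gt0//.
  by near: n; exact: nbhs_infty_ger.
by rewrite ltr0n; near: n; exact: nbhs_infty_gt.
Unshelve. all: by end_near. Qed.

(** With r = l^(1/4), ln l = 4 ln r <= 4 r, and 4 r <= e r^2 once r >= 4/e. *)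
Lemma near_ln_le_sqrt e : 0 < e -> \forall l \near +oo, ln l <= e * Num.sqrt l.
Proof.
move=> e0; near=> l.
have l0 : 0 < l by near: l; exact/nbhs_pinfty_gt/num_real.
have le4 : (4 / e) ^+ 4 <= l by near: l; exact/nbhs_pinfty_ge/num_real.
pose r := Num.sqrt (Num.sqrt l).
have r0 : 0 < r by rewrite !sqrtr_gt0.
have r2 : Num.sqrt l = r ^+ 2 by rewrite sqr_sqrtr ?sqrtr_ge0.
have r4 : l = r ^+ 4 by rewrite (exprM r 2 2) -r2 sqr_sqrtr// ltW.
have re : 4 <= r * e.
  rewrite -ler_pdivrMr// -(@ler_pXn2r _ 4)// ?nnegrE ?(ltW r0)//; first by rewrite -r4.
  by rewrite divr_ge0// ltW.
rewrite r2 r4 lnXn// -mulr_natl (@le_trans _ _ (4 * r))//.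
  by rewrite ler_pM2l// ltW// ln_sublinear.
by rewrite expr2 mulrA [e * r]mulrC ler_pM2r.
Unshelve. all: by end_near. Qed.

(** It suffices that l^(1/2 - p) reaches 1/e. Applied with p = [delta3], this makes the expected
    number of false discoveries vanish. *)
Lemma near_powR_le_sqrt e (p : R) : 0 < e -> p < 2^-1 ->
  \forall l \near +oo, l `^ p <= e * Num.sqrt l.
Proof.
move=> e0 p2; have q0 : 0 < 2^-1 - p by rewrite subr_gt0.
near=> l.
have l0 : 0 < l by near: l; exact/nbhs_pinfty_gt/num_real.
have le : (e^-1) `^ (2^-1 - p)^-1 <= l by near: l; exact/nbhs_pinfty_ge/num_real.
rewrite -powR12_sqrt ?(ltW l0)// -ler_pdivrMl// mulrC -ler_pdivlMl ?powR_gt0//.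
rewrite mulrC -powRB; last by rewrite (lt0r_neq0 l0) implybT.
have -> : e^-1 = (e^-1 `^ (2^-1 - p)^-1) `^ (2^-1 - p).
  by rewrite -powRrM mulVf ?powRr1 ?invr_ge0 ?(ltW e0)// lt0r_neq0.
by apply: ge0_ler_powR; rewrite ?nnegrE ?powR_ge0 ?(ltW l0) ?(ltW q0).
Unshelve. all: by end_near. Qed.

(** The bound exp z >= z^3/6 beats the quadratic factor, which is at most 6 s^2 for s >= 1; the
    product of the two sixes is the constant 36. *)
Lemma near_gaussian_gap e (B : R) : 0 < e -> 0 < B ->
  \forall s \near +oo, (2 * s ^+ 2 + 4) * expR (- (s * e)) <= B.
Proof.
move=> e0 B0; near=> s.
have s1 : 1 <= s by near: s; exact/nbhs_pinfty_ge/num_real.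
have sB : 36 / (e ^+ 3 * B) <= s by near: s; exact/nbhs_pinfty_ge/num_real.
have s0 : 0 < s by rewrite (lt_le_trans ltr01).
have e3 : 0 < e ^+ 3 by rewrite exprn_gt0.
rewrite expRN ler_pdivrMr ?expR_gt0//.
have se : (s * e) ^+ 3 / 6 <= expR (s * e).
  apply: le_trans (_ : 1 + (s * e) ^+ 3 / 3`!%:R <= _); first by rewrite lerDr.
  by apply: expR_ge1Dxn; rewrite mulr_ge0// ltW.
apply: (@le_trans _ _ (B * ((s * e) ^+ 3 / 6))); last by rewrite ler_pM2l.
have sB' : 36 <= s * (e ^+ 3 * B) by rewrite -ler_pdivrMr ?mulr_gt0.
apply: (@le_trans _ _ (6 * s ^+ 2)).
  have : 1 <= s ^+ 2 by rewrite exprn_ege1.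
  lra.
have -> : B * ((s * e) ^+ 3 / 6) = s * (e ^+ 3 * B) / 6 * s ^+ 2 by field.
by rewrite ler_wpM2r ?sqr_ge0// ler_pdivlMr//; apply: le_trans sB'; lra.
Unshelve. all: by end_near. Qed.

(** Write x = s + h with h >= e: the exponential factors as exp(-s^2/2) exp(-s h) exp(-h^2/2). The
    last factor absorbs x^2 <= 2 s^2 + 2 h^2, because h^2 exp(-h^2/2) <= 2. *)
Lemma sqr_expR_le (s e x : R) : 0 <= s -> 0 < e -> s + e <= x ->
  x ^+ 2 * expR (- (x ^+ 2 / 2)) <=
  expR (- (s ^+ 2 / 2)) * ((2 * s ^+ 2 + 4) * expR (- (s * e))).
Proof.
move=> s0 e0 sx; pose h := x - s.
have xE : x = s + h by rewrite /h addrC subrK.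
have eh : e <= h by rewrite /h lerBrDl.
have h0 : 0 < h by exact: lt_le_trans eh.
have x0 : 0 <= x by rewrite xE addr_ge0// ltW.
have -> : - (x ^+ 2 / 2) = - (s ^+ 2 / 2) - s * h - h ^+ 2 / 2 by rewrite xE; field.
rewrite !expRD -mulrA mulrCA ler_pM2l ?expR_gt0// mulrCA.
rewrite mulrC ler_pM ?mulr_ge0 ?expR_ge0 ?sqr_ge0//; last first.
  by rewrite ler_expR lerN2 ler_wpM2l.
have e1 : expR (- (h ^+ 2 / 2)) <= 1.
  by rewrite expR_le1 oppr_le0 divr_ge0 ?sqr_ge0.
have he : h ^+ 2 * expR (- (h ^+ 2 / 2)) <= 2.
  rewrite expRN ler_pdivrMr ?expR_gt0// mulrC -ler_pdivrMr//.
  by rewrite (le_trans _ (expR_ge1Dx _))// lerDr.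
have x2 : x ^+ 2 <= 2 * s ^+ 2 + 2 * h ^+ 2.
  by rewrite xE; have := sqr_ge0 (s - h); lra.
apply: (@le_trans _ _ ((2 * s ^+ 2 + 2 * h ^+ 2) * expR (- (h ^+ 2 / 2)))).
  by rewrite ler_wpM2r ?expR_ge0.
rewrite mulrDl lerD//; first by rewrite ler_piMr ?mulr_ge0 ?sqr_ge0.
rewrite -mulrA; lra.
Qed.

(** Lowering l by a small multiple of sqrt l lowers sqrt(2 l) by at most e: after squaring, 2 e
    sqrt(2 l) - e^2 >= e sqrt l >= 2 g. *)
Lemma sqrt_gap e l (g : R) : 0 < e -> e <= Num.sqrt l ->
  g <= e / 2 * Num.sqrt l ->
  Num.sqrt (2 * l) - e <= Num.sqrt (2 * (l - g)) /\
  Num.sqrt l <= Num.sqrt (2 * (l - g)).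
Proof.
move=> e0 el gl; have r0 : 0 < Num.sqrt l by exact: lt_le_trans el.
have l0 : 0 < l by rewrite -sqrtr_gt0.
have lE := sqr_sqrtr (ltW l0).
have gl2 : g <= l / 2.
  apply: (le_trans gl); rewrite -[in leRHS]lE; nra.
split; last by rewrite ler_wsqrtr//; lra.
have s0 : 0 < Num.sqrt (2 * l) by rewrite sqrtr_gt0 mulr_gt0.
have rs : Num.sqrt l <= Num.sqrt (2 * l) by rewrite ler_wsqrtr//; lra.
have se : 0 <= Num.sqrt (2 * l) - e by rewrite subr_ge0 (le_trans el).
rewrite -[leLHS]ger0_norm// -sqrtr_sqr ler_wsqrtr// sqrrB sqr_sqrtr ?mulr_ge0 ?(ltW l0)//.
nra.
Qed.

End growth.

Section thresholds.
Context {R : realType}.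

Lemma near_const_le_sqrt (k : R) : \forall l \near +oo, k <= Num.sqrt l.
Proof. by move: (@cvg_sqrt_pinfty R) => /cvgryPge; exact. Qed.

Lemma cvg_sqrt_double : Num.sqrt (2 * l) @[l --> +oo] --> (+oo : set_system R).
Proof.
apply/cvgryPge => k; near=> l.
have l0 : 0 < l by near: l; exact/nbhs_pinfty_gt/num_real.
apply: (@le_trans _ _ (Num.sqrt l)); last by rewrite ler_wsqrtr//; lra.
by near: l; exact: near_const_le_sqrt.
Unshelve. all: by end_near. Qed.

Lemma cvg_sqrt_2ln : Num.sqrt (2 * ln n%:R) @[n --> \oo] --> (+oo : set_system R).
Proof. exact: cvg_comp cvg_ln_nat cvg_sqrt_double. Qed.

(** Everything is measured against s = sqrt(2 ln n). Both ln q_n and the correction [g] are at most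
    of order ln ln n, hence o(sqrt(ln n)), so by [sqrt_gap] neither [m] nor [u] falls below s -
    e. *)
Lemma near_thresholds (q : nat -> nat) (delta2 c delta3 A0 B0 x0 e : R) :
  (forall n, (0 < q n)%N) ->
  (q n)%:R / n%:R @[n --> \oo] --> (0 : R) ->
  asymp_equiv (fun n => (q n)%:R) (fun n => ln n%:R `^ delta2) ->
  0 < c -> delta3 < 2^-1 -> 0 < A0 -> 0 < B0 -> 0 < e ->
  \forall n \near \oo,
    let s := Num.sqrt (2 * ln n%:R) : R in
    let alpha := c * ln n%:R `^ delta3 / n%:R in
    let m := Num.sqrt (2 * ln (n%:R / (q n)%:R)) in
    exists u, [/\ (q n <= n)%N /\ alpha <= 1,
      0 < u /\ A0 * alpha * expR (u ^+ 2 / 2) <= 2^-1,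
      2 * n%:R * (expR (- (u ^+ 2 / 2)) / u) <= e,
      s - e <= u /\ s - e <= m <= s &
      forall x, s + e <= `|x| ->
        x0 <= `|x| /\ x ^+ 2 * expR (- (x ^+ 2 / 2)) <= B0 * n%:R^-1].
Proof.
move=> q_gt0 q_sparse [c1 [c2 [c1_gt0 q_le]]] c_gt0 d3 A0_gt0 B0_gt0 e0.
have e4 : 0 < e / 4 by rewrite divr_gt0.
have near_l (Q : R -> Prop) : (\forall l \near +oo, Q l) ->
    \forall n \near \oo, Q (ln n%:R).
  by move=> Ql; exact: (cvg_ln_nat _ Ql).
have lnl (k : R) : 0 < k -> \forall n \near \oo, k * ln (ln n%:R) <= e / 4 * Num.sqrt (ln n%:R).
  move=> k0; apply: (near_l (fun l => k * ln l <= e / 4 * Num.sqrt l)).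
  have : 0 < e / 4 / k by rewrite divr_gt0.
  move=> /near_ln_le_sqrt; apply: filterS => z.
  by rewrite -[k * _ <= _]ler_pdivlMl// mulrA [k^-1 * _]mulrC.
near=> n.
set l := ln n%:R.
have n0 : (0 < n)%N by near: n; exact: nbhs_infty_gt.
have nR0 : 0 < n%:R :> R by rewrite ltr0n.
have l1 : 1 <= l.
  by rewrite /l; near: n; apply: (near_l (fun l => 1 <= l)); exact/nbhs_pinfty_ge/num_real.
have l0 : 0 < l by rewrite (lt_le_trans ltr01).
have el : e <= Num.sqrt l.
  by rewrite /l; near: n; apply: (near_l (fun l => e <= Num.sqrt l)); exact: near_const_le_sqrt.
have x0l : x0 <= Num.sqrt l.
  by rewrite /l; near: n; apply: (near_l (fun l => x0 <= Num.sqrt l)); exact: near_const_le_sqrt.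
have k1 : ln (2 * A0 * c) <= e / 4 * Num.sqrt l.
  rewrite -ler_pdivrMl//.
  by rewrite /l; near: n; apply: (near_l (fun l => _ <= Num.sqrt l)); exact: near_const_le_sqrt.
have k2 : ln c2 <= e / 4 * Num.sqrt l.
  rewrite -ler_pdivrMl//.
  by rewrite /l; near: n; apply: (near_l (fun l => _ <= Num.sqrt l)); exact: near_const_le_sqrt.
have lnl_ge0 : 0 <= ln l by rewrite ln_ge0.
have k3 : delta3 * ln l <= e / 4 * Num.sqrt l.
  apply: (@le_trans _ _ (2^-1 * ln l)); first by rewrite ler_wpM2r// ltW.
  by rewrite /l; near: n; exact: lnl.
have k4 : delta2 * ln l <= e / 4 * Num.sqrt l.
  apply: (@le_trans _ _ ((`|delta2| + 1) * ln l)).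
    by rewrite ler_wpM2r// (le_trans (ler_norm _))// lerDl.
  by rewrite /l; near: n; apply: lnl; rewrite ltr_wpDl.
have k5 : l `^ delta3 <= c^-1 * Num.sqrt l.
  rewrite /l; near: n; apply: (near_l (fun l => l `^ delta3 <= c^-1 * Num.sqrt l)).
  by apply: near_powR_le_sqrt => //; rewrite invr_gt0.
have k6 : l `^ delta3 <= e / (4 * A0 * c) * Num.sqrt l.
  rewrite /l; near: n; apply: (near_l (fun l => l `^ delta3 <= e / (4 * A0 * c) * Num.sqrt l)).
  by apply: near_powR_le_sqrt => //; rewrite divr_gt0// !mulr_gt0.
have gap : (2 * (Num.sqrt (2 * l)) ^+ 2 + 4) * expR (- (Num.sqrt (2 * l) * e)) <= B0.
  rewrite /l; near: n; apply: (near_l (fun l => (2 * (Num.sqrt (2 * l)) ^+ 2 + 4) *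
    expR (- (Num.sqrt (2 * l) * e)) <= B0)).
  exact: (cvg_sqrt_double _ (near_gaussian_gap _ _ e0 B0_gt0)).
have qn : (q n <= n)%N.
  have : (q n)%:R / n%:R <= 1 :> R.
    near: n; move/cvgr_le: q_sparse; exact.
  by rewrite ler_pdivrMr// mul1r ler_nat.
have qR0 : 0 < (q n)%:R :> R by rewrite ltr0n.
have qc2 : (q n)%:R <= c2 * l `^ delta2.
  have : c1 <= (q n)%:R / l `^ delta2 <= c2.
    by rewrite /l; near: n; exact: q_le.
  by move=> /andP[_]; rewrite ler_pdivrMr ?powR_gt0.
set s := Num.sqrt (2 * l); set alpha := c * _ / _; set m := Num.sqrt _.
have lE : expR l = n%:R by rewrite /l lnK ?posrE.
have s2 : s ^+ 2 = 2 * l by rewrite sqr_sqrtr// mulr_ge0// ltW.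
(* [2 A0 alpha = exp (g - l)], so that [u := sqrt (2 (l - g))] solves
   [A0 alpha exp (u^2 / 2) = 1 / 2]. *)
pose g := ln (2 * A0 * c) + delta3 * ln l.
have g_le : g <= e / 2 * Num.sqrt l by rewrite /g; lra.
have [gs gl] := sqrt_gap _ _ _ e0 el g_le.
have [qs _] : s - e <= Num.sqrt (2 * (l - ln (q n)%:R)) /\
    Num.sqrt l <= Num.sqrt (2 * (l - ln (q n)%:R)).
  apply: sqrt_gap => //.
  (* [asymp_equiv] leaves the sign of [c2] open; positivity of [q n] forces it. *)
  have c20 : 0 < c2.
    by rewrite -(pmulr_lgt0 _ (powR_gt0 delta2 l0)); exact: lt_le_trans qc2.
  have : ln (q n)%:R <= ln (c2 * l `^ delta2) by rewrite ler_ln ?posrE// (lt_le_trans _ qc2).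
  rewrite lnM ?posrE ?powR_gt0// ln_powR; lra.
have mE : m = Num.sqrt (2 * (l - ln (q n)%:R)) by rewrite /m ln_div ?posrE.
have sl0 : 0 < Num.sqrt l by rewrite sqrtr_gt0.
set u := Num.sqrt (2 * (l - g)) in gs gl.
have u0 : 0 < u by exact: lt_le_trans gl.
have u2 : u ^+ 2 / 2 = l - g.
  have : 0 < 2 * (l - g) by rewrite -sqrtr_gt0.
  by move=> /ltW h; rewrite sqr_sqrtr// mulrC mulKf.
have gE : expR g = 2 * A0 * c * l `^ delta3.
  rewrite /g expRD lnK ?posrE ?mulr_gt0//; congr (_ * _).
  by rewrite /powR gt_eqF.
exists u; split.
- split=> //; rewrite /alpha ler_pdivrMr// mul1r.
  apply: (@le_trans _ _ (Num.sqrt l)).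
    by rewrite -ler_pdivlMl.
  apply: (@le_trans _ _ l).
    rewrite -[leRHS](sqr_sqrtr (ltW l0)) expr2 ler_peMl ?(ltW sl0)//.
    by rewrite -[leLHS]sqrtr1 ler_wsqrtr.
  by rewrite /l ltW// ln_sublinear.
- split=> //; rewrite u2 expRD expRN lE gE /alpha.
  rewrite le_eqVlt; apply/orP; left; apply/eqP.
  by field; rewrite !gt_eqF// powR_gt0.
(* The factor n cancels, leaving a multiple of l^delta3 / u with u >= sqrt l, which is small because
   delta3 < 1/2. *)
- rewrite u2 opprB expRD expRN lE gE.
  have -> : 2 * n%:R * (2 * A0 * c * l `^ delta3 / n%:R / u) =
      4 * A0 * c * l `^ delta3 / u by field; rewrite !gt_eqF.
  rewrite ler_pdivrMr//; apply: (@le_trans _ _ (e * Num.sqrt l)).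
    have k0 : 0 < 4 * A0 * c by rewrite !mulr_gt0.
    by rewrite -ler_pdivlMl// mulrA [_^-1 * e]mulrC.
  by rewrite ler_pM2l.
- split=> //; rewrite mE qs/= ler_wsqrtr// ler_pM2l// gerBl ln_ge0//.
  by rewrite ler1n.
- move=> x sx; have s0 : 0 <= s by exact: sqrtr_ge0.
  have ls : Num.sqrt l <= s by rewrite ler_wsqrtr//; lra.
  split; first by rewrite (le_trans x0l)// (le_trans ls)// (le_trans _ sx)// lerDl ltW.
  rewrite -(real_normK (num_real x)) (le_trans (sqr_expR_le _ _ _ s0 e0 sx))//.
  rewrite mulrC [leRHS]mulrC -lE -expRN.
  have -> : s ^+ 2 / 2 = l by rewrite s2 mulrC mulKf.
  by rewrite mulrC ler_pM2l ?expR_gt0.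
Unshelve. all: by end_near. Qed.

End thresholds.

(** * The main theorem *)

(** The two-sided real bounds also rule out infinite values, as convergence to a finite limit in the
    extended reals demands. *)
Lemma cvge0_near {R : realType} (f : nat -> \bar R) :
  (forall e : R, 0 < e -> \forall n \near \oo, ((- e)%:E <= f n <= e%:E)%E) ->
  f n @[n --> \oo] --> (0 : \bar R)%E.
Proof.
move=> fe; apply/fine_cvgP; split.
  apply: filterS (fe 1 ltr01) => n /andP[h1 h2].
  by rewrite fin_numE -ltNye -ltey (lt_le_trans _ h1) ?ltNyr// (le_lt_trans h2) ?ltry.
apply/cvgrPdist_le => e e0; apply: filterS (fe e e0) => n.
rewrite sub0r normrN ler_norml /=; case: (f n) => [r| |]; rewrite ?lee_fin//= => _.
by rewrite oppr_le0 !ltW.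
Qed.
Theorem theorem6 (R : realType)
    (q : nat -> nat) (delta2 : R)
    (q_gt0 : forall n, (0 < q n)%N)
    (q_sparse : (q n)%:R / n%:R @[n --> \oo] --> (0 : R))
    (delta2_gt0 : 0 < delta2)
    (q_polylog : asymp_equiv (fun n => (q n)%:R) (fun n => ln n%:R `^ delta2))
    (K : R) (L : R -> R)
    (K_gt0 : 0 < K)
    (L_slow : slowly_varying L)
    (L_cont : {in `]0, +oo[, continuous L})
    (pi1_density : prob_density_pos (local_prior K 2^-1 L))
    (A1 : exists c0 t0 : R,
       [/\ 0 < c0, 0 < t0 & forall t, t0 <= t -> c0 <= L t])
    (A2 : exists M : R, 0 < M /\ forall t, 0 < t -> L t <= M)
    (c delta3 : R)
    (c_gt0 : 0 < c)
    (delta3_gt0 : 0 < delta3) (delta3_lt : delta3 < 2^-1)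
    (alpha : nat -> R)
    (alphaE : forall n, alpha n = c * ln n%:R `^ delta3 / n%:R)
    (pi2 : nat -> R -> R)
    (pi2_density : forall n, prob_density_pos (pi2 n))
    (pi2_supp : \forall n \near \oo,
       (\int[lebesgue_measure]_(tau in `[(n%:R^-1)%R, alpha n]) (pi2 n tau)%:E = 1)%E)
    (d : nat -> measure_display) (T : forall n, measurableType (d n))
    (P : forall n, probability (T n) R)
    (eps : forall n, 'I_n -> {RV (P n) >-> R})
    (eps_iid : forall n, iid_std_normal (eps n)) :
  let psi n := full_bayes_rule K 2^-1 L (pi2 n) (alpha n) (n := n) in
  (forall b : R,
     (sup_risk (eps n) (psi n) (q n) b - (1 - Phi b)%:E)%E
       @[n --> \oo] --> (0 : \bar R)%E) /\
  (forall b : nat -> R, b n @[n --> \oo] --> +oo ->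
     (sup_risk (eps n) (psi n) (q n) (b n) - (1 - Phi (b n))%:E)%E
       @[n --> \oo] --> (0 : \bar R)%E).
Proof.
move=> psi.
have [mL L_gt0 _] := L_slow.
have [c0 [t0 [c0_gt0 t0_gt0 L_ge]]] := A1.
have [M [_ L_le]] := A2.
have [A0 A0_gt0 condA] := cond_shrinkage_small K M c0 t0 L K_gt0 pi1_density mL
  L_gt0 L_le c0_gt0 t0_gt0 L_ge.
have [B0 [x0 [B0_gt0 x0_gt0 condB]]] := cond_shrinkage_large K M c0 t0 L K_gt0
  pi1_density mL L_gt0 L_le c0_gt0 t0_gt0 L_ge.
have eps_normal n (i : 'I_n) (A : set R) : measurable A ->
    distribution (P n) (eps n i) A = normal_prob 0 1 A.
  by have [+ _] := eps_iid n; exact.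
(* For each large n the bounds hold for all real [b] at once, so they serve a fixed [b] as well as a
   sequence b_n. *)
have bounds e : 0 < e -> \forall n \near \oo,
    [/\ forall b, (0 <= sup_risk (eps n) (psi n) (q n) b <= (1 - Phi b + 3 * e)%:E)%E &
      forall b, let m := Num.sqrt (2 * ln n%:R) - e + b in 0 < m ->
        ((Phi m - Phi b - e)%:E <= sup_risk (eps n) (psi n) (q n) b)%E].
  move=> e0.
  apply: filterS2 (near_thresholds q delta2 c delta3 A0 B0 x0 e q_gt0 q_sparse
    q_polylog c_gt0 delta3_lt A0_gt0 B0_gt0 e0) pi2_supp => n + supp_n.
  rewrite -alphaE /=; set s := Num.sqrt (2 * ln n%:R).
  set m := Num.sqrt (2 * ln (n%:R / _)).
  move=> [u [[qn alpha1] [u0 uA] ue [su /andP[sm ms]] xB]].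
  have psi_u (x : 'rV[R]_n) i : psi n x i -> u < `|x 0 i|.
    exact: (full_bayes_rule_gt K c0 t0 L K_gt0 pi1_density mL L_gt0 c0_gt0 t0_gt0 L_ge
      (pi2 n) n (alpha n) u A0 x i alpha1 (pi2_density n) supp_n (ltW A0_gt0) condA uA).
  have psi_v (x : 'rV[R]_n) i : s + e <= `|x 0 i| -> psi n x i.
    apply: (full_bayes_rule_true K c0 t0 L K_gt0 pi1_density mL L_gt0 c0_gt0 t0_gt0 L_ge
      (pi2 n) n (alpha n) (s + e) x i alpha1 (pi2_density n) supp_n).
    move=> tau y /andP[tau_n tau_a] /xB[xy yB].
    have n_gt0 : (0 < n)%N by exact: leq_ltn_trans (ltn_ord i).
    have tau0 : 0 < tau by rewrite (lt_le_trans _ tau_n)// invr_gt0 ltr0n.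
    apply: condB => //; first by rewrite tau0 (le_trans tau_a).
    by rewrite (le_trans yB)// ler_pM2l.
  split=> b.
    apply/andP; split; first exact: sup_risk_ge0.
    apply: le_trans (sup_risk_le (P n) n (eps n) (eps_normal n) (psi n) (q n) b u (s + e)
      (q_gt0 n) u0 _ psi_v) _; first by move=> x i /psi_u/ltW.
    rewrite -/m lee_fin.
    (* Since m >= s - e, the argument is at most 2 e - b; the Lipschitz bound costs 2 e and the
       false discoveries another e. *)
    have : Phi (s + e - (m + b)) <= Phi (- b + 2 * e) by apply: Phi_le; lra.
    have := Phi_lipschitz (- b) (- b + 2 * e); rewrite lerDl mulr_ge0 ?(ltW e0)// => /(_ isT).
    by rewrite Phi_sym; lra.
  set sb := s - e + b => sb0.
  have mb0 : 0 < m + b by rewrite (lt_le_trans sb0)// lerD2r.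
  apply: le_trans (sup_risk_ge (P n) n (eps n) (eps_normal n) (psi n) (q n) b u _
    (ltW u0) mb0 psi_u); last by rewrite q_gt0.
  rewrite -/m lee_fin.
  (* This uses u >= s - e and m <= s. The other tail, detection with the wrong sign, has probability
     at most 1 - Phi(sb). *)
  have : Phi (- b - e) <= Phi (u - (m + b)) by apply: Phi_le; lra.
  have := Phi_lipschitz (- b - e) (- b); rewrite gerBl (ltW e0) => /(_ isT).
  have : Phi (- u - (m + b)) <= Phi (- sb) by apply: Phi_le; rewrite /sb; lra.
  by rewrite !Phi_sym; lra.
have Phi_near (u : nat -> R) e : 0 < e -> u n @[n --> \oo] --> +oo ->
    \forall n \near \oo, 1 - e <= Phi (u n).
  move=> e0 u_infty.
  have /cvgr_ge : Phi (u n) @[n --> \oo] --> (1 : R) by exact: cvg_comp u_infty Phi_cvg1.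
  by apply; rewrite gtrBl.
(* The upper bound in [bounds] costs three times its parameter, whence e / 3. *)
split=> b => [|b_infty]; apply: cvge0_near => e e0; have e3 : 0 < e / 3 by rewrite divr_gt0.
  have s_infty : Num.sqrt (2 * ln n%:R) - e / 3 + b @[n --> \oo] --> +oo.
    apply/cvgryPge => k; move: (@cvg_sqrt_2ln R) => /cvgryPge/(_ (k + e / 3 - b)).
    by apply: filterS => n; lra.
  have s_gt0 : \forall n \near \oo, 0 < Num.sqrt (2 * ln n%:R) - e / 3 + b.
    by move: s_infty => /cvgryPgt; exact.
  apply: filterS3 (bounds _ e3) (Phi_near _ _ e3 s_infty) s_gt0.
  move=> n [upper lower] Phi_s /lower low.
  have /andP[_ up] := upper b.
  rewrite leeBrDr// leeBlDr// -!EFinD; apply/andP; split.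
    by apply: le_trans low; rewrite lee_fin; lra.
  by apply: (le_trans up); rewrite lee_fin; lra.
(* When b_n tends to infinity, 1 - Phi(b_n) tends to 0, so nonnegativity of the risk is lower bound
   enough. *)
apply: filterS2 (bounds _ e3) (Phi_near b _ e0 b_infty) => n [upper _] Phi_b.
have /andP[ge0 up] := upper (b n).
rewrite leeBrDr// leeBlDr// -!EFinD; apply/andP; split.
  by apply: le_trans ge0; rewrite lee_fin; lra.
by apply: (le_trans up); rewrite lee_fin; lra.
Qed.
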